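(* Let $H$ be the group generated by elements $x_i$ ($i\in\mathbb{N}=\{1,2,3,\dots\}$) that is freest subject to the following conditions: (1) $x_i^2=1$ for all $i\in\mathbb{N}$; (2) the normal closure $\langle x_i\rangle^H$ is abelian for all $i\in\mathbb{N}$; (3) $h^4=1$ for all $h\in H$. Let $\overline{H}=H/R_2(H)$. Then $\overline{H}$ satisfies the following condition: (4) every involution $u\in\overline{H}$ is left $2$-Engel in $\overline{H}$, i.e. $[x,u,u]=1$ for all $x\in\overline{H}$. Furthermore, $\overline{H}$ is not solvable. Consequently, for $n\in\mathbb{N}$ let $\langle x_1,\dots,x_n\rangle$ be the subgroup of $H$ generated by $x_1,\dots,x_n$, and put $$\overline{H}_n=\frac{\langle x_1,\dots,x_n\rangle}{R_2(\langle x_1,\dots,x_n\rangle)}.$$ Then each $\overline{H}_n$ is a finite $2$-group satisfying the analogues of conditions (1)--(4), namely: the images of $x_1,\dots,x_n$ in $\overline{H}_n$ (which generate it) have square equal to $1$; each of these images has abelian normal closure in $\overline{H}_n$; $h^4=1$ for all $h\in\overline{H}_n$; and every involution of $\overline{H}_n$ is left $2$-Engel in $\overline{H}_n$. Moreover, there is no upper bound on the solvability (derived) lengths of the groups $\overline{H}_n$, $n\in\mathbb{N}$.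
   Context: Commutators are $[x,y]=x^{-1}y^{-1}xy$ and are left-normed: $[x,y,z]=[[x,y],z]$. An involution is an element of order $2$. An element $u$ of a group $G$ is left $2$-Engel in $G$ if $[x,u,u]=1$ for all $x\in G$; this is equivalent to the normal closure $\langle u\rangle^G$ of $u$ in $G$ being abelian. For a group $G$, the set of right $2$-Engel elements is $$R_2(G)=\{a\in G \mid [a,x,x]=1 \text{ for all } x\in G\},$$ which is known to be a characteristic subgroup of $G$. ''Freest'' means given by the corresponding presentation: $H$ is the quotient of the free group $F$ on $\{x_i\mid i\in\mathbb{N}\}$ by the normal subgroup generated by all $x_i^2$ ($i\in\mathbb{N}$), all $[f,x_i,x_i]$ ($f\in F$, $i\in\mathbb{N}$), and all $f^4$ ($f\in F$). *)

(* Defs.v *)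
From HB Require Import structures.
From mathcomp Require Import all_boot.
From mathcomp Require Import boolp classical_sets functions cardinality.
Set Implicit Arguments.
Unset Strict Implicit.
Unset Printing Implicit Defensive.
Local Open Scope classical_set_scope.
Local Open Scope card_scope.
Local Open Scope quotient_scope.
Local Open Scope group_scope.

(* Commutators are those of mathcomp's monoid.v: [~ x, y] unfolds to
   x^-1 * (y^-1 * (x * y)), and [~ x, y, z] to [~ [~ x, y], z]. *)

Section Subgroups.
Variable G : groupType.
Implicit Types (A : set G) (x y : G).

Definition is_subgroup A := A 1 /\ forall x y, A x -> A y -> A (x * y^-1).

Definition is_normal_subgroup A :=
  is_subgroup A /\ forall x g, A x -> A (x ^ g).

Lemma is_subgroupV A x : is_subgroup A -> A x -> A x^-1.
Proof. by move=> [A1 AF] Ax; rewrite -[x^-1]mul1g; apply: AF. Qed.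

Lemma is_subgroupM A x y : is_subgroup A -> A x -> A y -> A (x * y).
Proof.
by move=> gA Ax Ay; rewrite -[y]invgK; apply: gA.2 => //; apply: is_subgroupV.
Qed.

Definition generated A : set G := smallest is_subgroup A.

Definition normal_closure A : set G := smallest is_normal_subgroup A.

Lemma generated_subgroup A : is_subgroup (generated A).
Proof.
split=> [B [[B1 _] _] //|x y Ax Ay B BP].
by apply: BP.1.2; [apply: Ax|apply: Ay].
Qed.

Lemma normal_closure_normal A : is_normal_subgroup (normal_closure A).
Proof.
split; first split.
- by move=> B [[[B1 _] _] _].
- by move=> x y Ax Ay B BP; apply: BP.1.1.2; [apply: Ax|apply: Ay].
- by move=> x g Ax B BP; apply: BP.1.2; apply: Ax.
Qed.

Record subgroup := Subgroup {
  subgroup_set :> set G;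
  subgroupP : is_subgroup subgroup_set }.

Record normal_subgroup := NormalSubgroup {
  normal_subgroup_set :> set G;
  normal_subgroupP : is_normal_subgroup normal_subgroup_set }.

Definition abelian_set A := forall x y, A x -> A y -> commute x y.

Fixpoint derived (n : nat) : set G :=
  if n is m.+1 then
    generated [set [~ x, y] | x in derived m & y in derived m]
  else setT.

Definition solvable_group := exists n, derived n = [set 1].

Definition has_derived_length (l : nat) :=
  derived l = [set 1] /\ forall m, derived m = [set 1] -> (l <= m)%N.

Definition finite_pgroup (p : nat) := exists k, [set: G] #= `I_(p ^ k).

Definition involution x := x != 1 /\ x ^+ 2 = 1.

Definition left_2Engel u := forall x, [~ x, u, u] = 1.

Definition right_2Engel a := forall x, [~ a, x, x] = 1.

End Subgroups.

Arguments derived : clear implicits.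
Arguments solvable_group : clear implicits.
Arguments has_derived_length : clear implicits.
Arguments finite_pgroup : clear implicits.

Section SubgroupType.
Variables (G : groupType) (A : subgroup G).

Definition subgroup_type := {x : G | x \in (A : set G)}.

HB.instance Definition _ := SubChoice.on subgroup_type.

Lemma subgroup_group_closed : group_closed (mem (A : set G)).
Proof.
have gA := subgroupP A; split; first by rewrite inE; apply: gA.1.
move=> x y /set_mem Ax /set_mem Ay; apply/mem_set; exact: gA.2.
Qed.

HB.instance Definition _ :=
  SubChoice_isSubGroup.Build G _ subgroup_type subgroup_group_closed.

End SubgroupType.

Section Quotient.
Variables (G : groupType) (N : normal_subgroup G).
Implicit Types x y : G.

Definition same_coset x y : bool := `[< normal_subgroup_set N (x^-1 * y) >].

Lemma same_coset_equiv : equiv_class_of same_coset.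
Proof.
have [gN _] := normal_subgroupP N; split.
- by move=> x; apply/asboolP; rewrite mulVg; apply: gN.1.
- move=> x y; apply/asboolP/asboolP => /(is_subgroupV gN);
  by rewrite invgM invgK.
- move=> y x z /asboolP Nxy /asboolP Nyz; apply/asboolP.
  by rewrite -[x^-1](mulgK y) -mulgA; apply: is_subgroupM.
Qed.

Canonical same_coset_equiv_rel := EquivRelPack same_coset_equiv.

Definition quotient := {eq_quot same_coset_equiv_rel}.

HB.instance Definition _ := Choice.on quotient.
HB.instance Definition _ := EqQuotient.on quotient.

Definition coset x : quotient := \pi_(quotient) x.

Lemma coset_eqP x y : coset x = coset y <-> normal_subgroup_set N (x^-1 * y).
Proof.
split=> [/eqmodP/asboolP //|Nxy].
by apply/eqmodP/asboolP.
Qed.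

Lemma coset_surj (q : quotient) : exists x, coset x = q.
Proof. by exists (repr q); rewrite /coset reprK. Qed.

Definition quotient_mul (p q : quotient) : quotient := coset (repr p * repr q).
Definition quotient_inv (q : quotient) : quotient := coset (repr q)^-1.

Lemma coset_repr (q : quotient) : coset (repr q) = q.
Proof. by rewrite /coset reprK. Qed.

Lemma quotient_mulE x y : quotient_mul (coset x) (coset y) = coset (x * y).
Proof.
have [gN nN] := normal_subgroupP N.
apply/coset_eqP; set x' := repr _; set y' := repr _.
have /coset_eqP Nx : coset x' = coset x by rewrite coset_repr.
have /coset_eqP Ny : coset y' = coset y by rewrite coset_repr.
have -> : (x' * y')^-1 * (x * y) = (x'^-1 * x) ^ y' * (y'^-1 * y).
  by rewrite /conjg invgM !mulgA mulgK.
by apply: is_subgroupM => //; apply: nN.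
Qed.

Lemma quotient_invE x : quotient_inv (coset x) = coset x^-1.
Proof.
have [gN nN] := normal_subgroupP N.
apply/coset_eqP; set x' := repr _.
have /coset_eqP Nx : coset x' = coset x by rewrite coset_repr.
have -> : (x'^-1)^-1 * x^-1 = ((x'^-1 * x) ^ x'^-1)^-1.
  by rewrite /conjg !invgM !invgK !mulgA mulgK.
by apply: is_subgroupV => //; apply: nN.
Qed.

Fact quotient_mulA : associative quotient_mul.
Proof.
move=> p q r; rewrite -(coset_repr p) -(coset_repr q) -(coset_repr r).
by rewrite !quotient_mulE mulgA.
Qed.

Fact quotient_mul1 : left_id (coset 1) quotient_mul.
Proof. by move=> q; rewrite -(coset_repr q) quotient_mulE mul1g. Qed.

Fact quotient_mulr1 : right_id (coset 1) quotient_mul.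
Proof. by move=> q; rewrite -(coset_repr q) quotient_mulE mulg1. Qed.

Fact quotient_mulV : left_inverse (coset 1) quotient_inv quotient_mul.
Proof.
by move=> q; rewrite -(coset_repr q) quotient_invE quotient_mulE mulVg.
Qed.

Fact quotient_mulrV : right_inverse (coset 1) quotient_inv quotient_mul.
Proof.
by move=> q; rewrite -(coset_repr q) quotient_invE quotient_mulE mulgV.
Qed.

HB.instance Definition _ := isGroup.Build quotient
  quotient_mulA quotient_mul1 quotient_mulr1 quotient_mulV quotient_mulrV.

Lemma cosetM x y : coset (x * y) = coset x * coset y.
Proof. by rewrite -quotient_mulE. Qed.

Lemma coset1 : coset 1 = 1. Proof. by []. Qed.

Lemma coset_eq1 x : coset x = 1 <-> normal_subgroup_set N x.
Proof.
by rewrite -coset1; split=> [/esym/coset_eqP|Nx]; last apply/esym/coset_eqP;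
  rewrite invg1 mul1g.
Qed.

End Quotient.

Section FreeGroup.
Variable T : choiceType.

(* The letter (t, true) stands for t and (t, false) for t^-1. *)
Definition letter : Type := (T * bool)%type.
HB.instance Definition _ := Choice.on letter.
Implicit Types (a b : letter) (u v w : seq letter).

Definition letter_inv a : letter := (a.1, ~~ a.2).

Definition reduced w := sorted (fun a b => b != letter_inv a) w.

Definition push a w :=
  if w is b :: v then if b == letter_inv a then v else a :: w else [:: a].

Definition word_inv w := rev (map letter_inv w).

Lemma letter_invK : involutive letter_inv.
Proof. by case=> t e; rewrite /letter_inv /= negbK. Qed.

Lemma push_reduced a w : reduced w -> reduced (push a w).
Proof.
case: w => //= b w rw; case: ifP => [_|/negbT ba]; first exact: path_sorted rw.
by rewrite /reduced /= ba.
Qed.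

Lemma act_reduced u w : reduced w -> reduced (foldr push w u).
Proof. by move=> rw; elim: u => //= a u; apply: push_reduced. Qed.

Lemma pushK a w : reduced w -> push (letter_inv a) (push a w) = w.
Proof.
case: w => [|b w] /= rw; first by rewrite letter_invK eqxx.
case: eqP rw => [->|_] /=; last by rewrite letter_invK eqxx.
by case: w => //= c w; rewrite letter_invK => /andP[/negbTE ->].
Qed.

Lemma act_push a v w : reduced v -> reduced w ->
  foldr push w (push a v) = push a (foldr push w v).
Proof.
move=> rv rw; case: v rv => //= b v rv; case: eqP => //= ->.
by rewrite -{1}[a]letter_invK pushK //; apply: act_reduced.
Qed.

Lemma act_nil u : reduced u -> foldr push [::] u = u.
Proof.
elim: u => //= a u IH ru; rewrite IH; last exact: path_sorted ru.
by case: u ru {IH} => //= b u /andP[/negbTE ->].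
Qed.

Lemma act_inv u w : reduced w -> foldr push (foldr push w u) (word_inv u) = w.
Proof.
move=> rw; elim: u => //= a u IH.
by rewrite /word_inv /= rev_cons foldr_rcons pushK //; apply: act_reduced.
Qed.

Lemma word_inv_reduced u : reduced u -> reduced (word_inv u).
Proof.
rewrite /reduced rev_sorted sorted_map; apply: sub_sorted => a b /=.
by apply: contra => /eqP/(can_inj letter_invK) ->; rewrite letter_invK.
Qed.

Lemma word_invK : involutive word_inv.
Proof. by move=> u; rewrite /word_inv map_rev revK mapK //; apply: letter_invK. Qed.

Definition free_group := {w : seq letter | reduced w}.
HB.instance Definition _ := SubChoice.on free_group.

Definition free_mul (u v : free_group) : free_group :=
  Sub (foldr push (val v) (val u)) (act_reduced (val u) (valP v)).
Definition free_one : free_group := Sub [::] isT.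
Definition free_inv (u : free_group) : free_group :=
  Sub (word_inv (val u)) (word_inv_reduced (valP u)).

Fact free_mulA : associative free_mul.
Proof.
case=> u ru [v rv] [w rw]; apply: val_inj => /=.
elim: u {ru} => //= a u ->; rewrite act_push //; exact: act_reduced.
Qed.

Fact free_mul1 : left_id free_one free_mul.
Proof. by move=> u; apply: val_inj. Qed.

Fact free_mulr1 : right_id free_one free_mul.
Proof. by case=> u ru; apply: val_inj; rewrite /= act_nil. Qed.

Fact free_mulV : left_inverse free_one free_inv free_mul.
Proof.
case=> u ru; apply: val_inj => /=.
by have := act_inv u (isT : reduced [::]); rewrite act_nil.
Qed.

Fact free_mulrV : right_inverse free_one free_inv free_mul.
Proof.
case=> u ru; apply: val_inj => /=; have := word_inv_reduced ru.
have := act_inv (word_inv u) (isT : reduced [::]); rewrite word_invK.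
by move=> e r; rewrite act_nil in e.
Qed.

HB.instance Definition _ := isGroup.Build free_group
  free_mulA free_mul1 free_mulr1 free_mulV free_mulrV.

Definition free_gen (t : T) : free_group := Sub [:: (t, true)] isT.

Section Lift.
Variables (G : groupType) (f : T -> G).

Definition eval_letter a : G := if a.2 then f a.1 else (f a.1)^-1.

Definition free_lift (u : free_group) : G :=
  foldr (fun a g => eval_letter a * g) 1 (val u).

Lemma free_liftM : {morph free_lift : u v / u * v}.
Proof.
case=> u ru [v rv]; rewrite /free_lift /=; elim: u {ru} => /= [|a u IH].
  by rewrite mul1g.
rewrite -mulgA -{}IH; case: (foldr push v u) => //= b w.
case: eqP => //= ->; rewrite mulgA /eval_letter /=.
by case: a.2; rewrite /= ?mulgV ?mulVg mul1g.
Qed.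

Lemma free_lift_gen t : free_lift (free_gen t) = f t.
Proof. by rewrite /free_lift /= mulg1. Qed.

End Lift.

Lemma free_generated : generated (range free_gen) = setT.
Proof.
rewrite -subTset => -[u ru] _; have gF := generated_subgroup (range free_gen).
elim: u ru => [|a u IH] ru.
  by have -> : exist _ [::] ru = 1 :> free_group; [apply: val_inj | apply: gF.1].
have ru' : reduced u by apply: path_sorted ru.
have Ga : generated (range free_gen) (Sub [:: a] isT : free_group).
  case: a {ru} => t [] => [|].
    by move=> B [_]; apply; exists t => //; apply: val_inj.
  have -> : Sub [:: (t, false)] isT = (free_gen t)^-1 :> free_group.
    exact: val_inj.
  by apply: (is_subgroupV gF) => B [_]; apply; exists t.
have -> : exist (fun w => reduced w) (a :: u) ru =
    (Sub [:: a] isT : free_group) * (exist (fun w => reduced w) u ru').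
  apply: val_inj => /=; case: u ru {IH ru'} => //= b u /andP[/negbTE -> //].
exact: (is_subgroupM gF Ga (IH ru')).
Qed.

End FreeGroup.

(* R_2(G) is a normal subgroup (Kappe).  On the abelian normal closure A of a
   right 2-Engel element, each u |-> [~ u, x] is an endomorphism with square
   zero; hence [~ u, x, y, x] = 1 on A, and closure under products follows. *)
Section RightEngel.
Variable G : groupType.
Implicit Types a b u v x y g : G.

Lemma right_2Engel_commute a x : right_2Engel a -> commute [~ a, x] x.
Proof. by move=> /(_ x)/eqP/commgP. Qed.

Lemma right_2EngelJ a g : right_2Engel a -> right_2Engel (a ^ g).
Proof.
move=> aP x; rewrite -[x](conjgKV g) -!conjRg.
by rewrite (aP (x ^ g^-1)) conj1g.
Qed.

Let gsimp := (@invgM G, @invgK G, @mulgA G, @mulgK G, @mulgVK G, @mulgV G,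
  @mulVg G, @mulg1 G, @mul1g G).

Lemma commgMr u x y : [~ u, x * y] = [~ u, y] * [~ u, x] ^ y.
Proof. by rewrite /commg /conjg !gsimp. Qed.

Lemma commgMl u v x : [~ u * v, x] = [~ u, x] ^ v * [~ v, x].
Proof. by rewrite /commg /conjg !gsimp. Qed.

Lemma right_2Engel_commuteJ a g : right_2Engel a -> commute a (a ^ g).
Proof.
move=> aP; have -> : a ^ g = a * [~ a, g] by rewrite commgEl mulVKg.
apply: commuteM => //; apply/commute_sym.
have := right_2Engel_commute (g * a) aP.
rewrite commgMr commgg mul1g => /(congr1 (conjg ^~ a^-1)).
rewrite /= (conjMg _ (g * a)) (conjMg (g * a)) conjgK => e.
have : commute [~ a, g] (a * g * g^-1).
  apply: commuteM; last exact/commuteV/right_2Engel_commute.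
  by move: e; rewrite /commute /conjg !gsimp.
by rewrite mulgK.
Qed.

Section NormalClosure.
Variable a : G.
Hypothesis aP : right_2Engel a.
Let A := normal_closure [set a].

Let sgA : is_subgroup A.
Proof. by have [] := normal_closure_normal [set a]. Qed.

Let AJ u g : A u -> A (u ^ g).
Proof. by have [_] := normal_closure_normal [set a]; apply. Qed.

Let Aa : A a. Proof. by move=> B [_]; apply. Qed.

Let AR u x : A u -> A [~ u, x].
Proof.
move=> Au; rewrite commgEl; apply: (is_subgroupM sgA); last exact: AJ.
exact: (is_subgroupV sgA).
Qed.

Let centraliser_normal (B : set G) : (forall u g, B u -> B (u ^ g)) ->
  is_normal_subgroup [set u | forall v, B v -> commute u v].
Proof.
move=> BJ; split; [split|] => /=.
- by move=> v _; apply/commute_sym/commute1.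
- move=> x y xB yB v Bv; apply/commute_sym/commuteM.
    exact/commute_sym/xB.
  by apply: commuteV; apply/commute_sym/yB.
- move=> x g xB v Bv; have := xB _ (BJ v g^-1 Bv).
  by move=> /(congr1 (conjg ^~ g)); rewrite /= (conjMg x) (conjMg _ x) conjgKV.
Qed.

Lemma right_2Engel_closure_abelian : abelian_set A.
Proof.
have cA v : A v -> commute a v.
  move=> Av; apply/commute_sym.
  pose C := [set b | exists g, b = a ^ g].
  have CJ u g : C u -> C (u ^ g) by case=> h ->; exists (h * g); rewrite conjgM.
  have : A `<=` [set u | forall v, C v -> commute u v].
    apply: smallest_sub; first exact: centraliser_normal.
    by move=> _ -> _ [g ->]; apply: right_2Engel_commuteJ.
  by move/(_ v Av a); apply; exists 1; rewrite conjg1.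
have : A `<=` [set u | forall v, A v -> commute u v].
  apply: smallest_sub; first exact: (centraliser_normal AJ).
  by move=> _ ->.
by move=> h u v Au Av; apply: h.
Qed.

Let cAA := right_2Engel_closure_abelian.

Let DM u v x : A u -> A v -> [~ u * v, x] = [~ u, x] * [~ v, x].
Proof.
move=> Au Av; rewrite commgMl; congr (_ * _).
by apply/conjg_fixP/commgP/cAA => //; apply: AR.
Qed.

Let D2 u x : A u -> [~ u, x, x] = 1.
Proof.
move=> Au; suff: A `<=` [set v | A v /\ right_2Engel v].
  by move=> /(_ u Au)[_]; apply.
apply: smallest_sub => [|_ -> //]; split; [split|].
- by split=> [|y]; [exact: sgA.1|rewrite !comm1g].
- move=> v w [Av vP] [Aw wP]; split; first exact: sgA.2.
  have AwV : A w^-1 by exact: (is_subgroupV sgA).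
  move=> y; rewrite DM // DM; try exact: AR.
  rewrite vP mul1g; have : [~ w * w^-1, y, y] = 1 by rewrite mulgV !comm1g.
  by rewrite DM // DM ?wP ?mul1g //; apply: AR.
- by move=> v g [Av vP]; split; [exact: AJ|exact: right_2EngelJ].
Qed.

Let DR u x y : A u ->
  [~ u, x * y] = [~ u, y] * ([~ u, x] * [~ u, x, y]).
Proof. by rewrite commgMr (commgEl [~ u, x]) mulVKg. Qed.

Let D3 u x y : A u -> [~ u, x, y, x] = 1.
Proof.
move=> Au.
have I v : A v -> [~ v, x, y] * (([~ v, y, x] * [~ v, x, y, x]) *
    ([~ v, y, x, y] * [~ v, x, y, x, y])) = 1.
  move=> Av; rewrite -[RHS](D2 (x * y) Av) (DR x y (AR _ Av)) (DR _ _ Av).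
  set p := [~ v, x]; set q := [~ v, y]; set r := [~ p, y].
  have Ap : A p by exact: AR.
  have Aq : A q by exact: AR.
  have Ar : A r by exact: AR.
  have Apr : A (p * r) by exact: (is_subgroupM sgA).
  rewrite (DM x Aq Apr) (DM x Ap Ar) (DM y Aq Apr) (DM y Ap Ar).
  rewrite (D2 y Av) (D2 x Av) (D2 y Ap) !mul1g mulg1.
  by rewrite (DM y (AR x Aq) (AR x Ar)).
have := I _ (AR x Au); rewrite (D2 x Au) !comm1g mul1g !mulg1.
by rewrite (commgEl _ y) mulVKg => /eqP; rewrite conjg_eq1 => /eqP.
Qed.

Lemma right_2EngelM b : right_2Engel b -> right_2Engel (a * b).
Proof.
move=> bP x; apply/eqP/commgP; rewrite commgMl.
have -> : [~ a, x] ^ b = [~ a, x] * [~ a, x, b].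
  by rewrite (commgEl [~ a, x]) mulVKg.
apply/commute_sym/commuteM; last exact/commute_sym/right_2Engel_commute.
apply: commuteM; first exact/commute_sym/right_2Engel_commute.
by apply/commute_sym/commgP/eqP/D3.
Qed.

Lemma right_2EngelV : right_2Engel a^-1.
Proof.
move=> x; apply/eqP/commgP/commute_sym.
have AaV : A a^-1 by exact: (is_subgroupV sgA).
have : [~ a * a^-1, x] = 1 by rewrite mulgV comm1g.
rewrite (DM x Aa AaV) => /(canRL (mulKg _)); rewrite mulg1 => ->.
exact/commuteV/commute_sym/right_2Engel_commute.
Qed.

End NormalClosure.

Lemma right_2Engel_normal : is_normal_subgroup [set a : G | right_2Engel a].
Proof.
split; [split=> [x|a b /= aP bP]|by move=> x g; apply: right_2EngelJ].
  by rewrite !comm1g.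
by apply: right_2EngelM => //; apply: right_2EngelV.
Qed.

Definition R2 : normal_subgroup G := NormalSubgroup right_2Engel_normal.

End RightEngel.

Arguments R2 : clear implicits.

(* Generators are indexed from 0: x_{i+1} is [gen i], and the subgroup
   generated by x_1, ..., x_n is generated by the [gen i] with i < n. *)
Definition relators : set (free_group nat) :=
  [set free_gen i ^+ 2 | i in setT] `|`
  [set [~ f, free_gen i, free_gen i] | f in setT & i in setT] `|`
  [set f ^+ 4 | f in setT].

Definition relator_subgroup : normal_subgroup (free_group nat) :=
  NormalSubgroup (normal_closure_normal relators).

Definition H : groupType := quotient relator_subgroup.

Definition gen (i : nat) : H := coset relator_subgroup (free_gen i).

Definition Hbar : groupType := quotient (R2 H).

Definition gen_subgroup (n : nat) : subgroup H :=
  Subgroup (generated_subgroup [set gen i | i in `I_n]).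

Definition Hsub (n : nat) : groupType := subgroup_type (gen_subgroup n).

Lemma gen_in n (i : 'I_n) : gen i \in (gen_subgroup n : set H).
Proof. by apply/mem_set => B [_]; apply; exists (i : nat) => //=. Qed.

Definition gen_sub n (i : 'I_n) : Hsub n := Sub (gen i) (gen_in i).

Definition Hbarn (n : nat) : groupType := quotient (R2 (Hsub n)).

Definition gen_bar n (i : 'I_n) : Hbarn n := coset (R2 (Hsub n)) (gen_sub i).

(* Main.v *)
Require Import Defs.
From HB Require Import structures.
From mathcomp Require Import all_boot all_algebra.
From mathcomp Require Import zify.
From mathcomp Require Import boolp classical_sets functions cardinality.
Set Implicit Arguments.
Unset Strict Implicit.
Unset Printing Implicit Defensive.
Import GRing.Theory.

(** Three independent ideas, all about groups of exponent 4 generated by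
    involutions with abelian normal closures.

    Involutions of the quotient by [R2].  Let [K] be such a group, [s] one of
    the generators, and [u] such that [u ^+ 2] is right 2-Engel.  Conjugation
    makes [K] act by unipotent operators on the normal closure [A] of [s], which
    is an elementary abelian 2-group: [(g - 1) ^ 3 = 0] since [K] has exponent
    4, and [(w - 1) k (w - 1) = 0] for all [k] if [w] is left 2-Engel.  Take
    [w = [~ s', k]] for any generator [s'].  It is a product of two squares
    and so commutes with the right 2-Engel elements of order 2; for [U = u - 1]
    and [W = w - 1] this makes [U ^ 2] annihilate [W] across words in [U] and
    [D = d - 1].  The cubes of [u d - 1], [u d w - 1] and their variants then
    force [U D U W = 0] ([sandwich_vanish]).  Hence [[~ [~ s, u] ^ d, u]]
    commutes with all [[~ s', k]], therefore with all squares, and an element of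
    [A] that commutes with all squares is right 2-Engel.  Writing [x] as a word
    in the generators gives [[~ x, u, u] \in R2] for all [x]
    ([left_2Engel_mod_R2]).

    Non-solvability.  Take a commutative ring of characteristic 2 with elements
    [om i j] and let [x_i] send a pair [(m, F)] of a scalar and a vector to
    [(m + F i, F + m * om i)].  With suitable relations between the [om i j] this
    is an action of the freest group; the hard relators are the fourth powers,
    and [(g - 1) ^ 3 = 0] is obtained by following the coefficients of [g] along
    a word ([coefs_inv], [action_pow4]).  Commutators of the generators nested
    as in the derived series act through monomials in the [om i j] with distinct
    indices ([act_nested]).  If such a commutator [y] were right 2-Engel, then,
    having trivial square, it would commute with the square [[~ x_a, x_b]] of
    [x_a * x_b] for two further letters; but [[~ x_a, x_b, y]] acts through the
    monomial of [y] multiplied by [om a b].  It remains to find a ring where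
    these monomials are not 0.  Reading [om i j] as the condition that [i] and
    [j] have different colours, the ring is cut out of formal sums of monomials
    by counting modulo 2 the colourings that are proper for a monomial and for
    a reference matching ([pairing], [matching_ring]).

    Finiteness.  In a group generated by [n] involutions with abelian normal
    closures, the normal closure of the last one is an elementary abelian
    2-group, generated by conjugates that are indexed by the quotient; and this
    quotient is generated by [n - 1] such involutions.  So the group is a finite
    2-group of derived length at most [n] ([involutions_finite_solvable]), while
    the nested commutators show that the derived lengths are unbounded. *)

(** * Polynomial identities in characteristic two *)

Inductive c2expr :=
  C2zero | C2one | C2atom of nat | C2add of c2expr & c2expr
| C2mul of c2expr & c2expr.

Fixpoint c2words (e : c2expr) : seq (seq nat) :=
  match e with
  | C2zero => [::]
  | C2one => [:: [::]]
  | C2atom i => [:: [:: i]]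
  | C2add e1 e2 => c2words e1 ++ c2words e2
  | C2mul e1 e2 => [seq u ++ v | u <- c2words e1, v <- c2words e2]
  end.

Definition c2toggle (w : seq nat) (s : seq (seq nat)) :=
  if w \in s then rem w s else w :: s.

Definition c2reduce (s : seq (seq nat)) := foldr c2toggle [::] s.

Section CharTwo.
Local Open Scope ring_scope.
Variables (R : pzRingType) (env : seq R).
Hypothesis char2 : forall x : R, x + x = 0.

Definition c2word (w : seq nat) : R := \prod_(i <- w) env`_i.

Definition c2sum (s : seq (seq nat)) : R := \sum_(w <- s) c2word w.

Fixpoint c2eval (e : c2expr) : R :=
  match e with
  | C2zero => 0
  | C2one => 1
  | C2atom i => env`_i
  | C2add e1 e2 => c2eval e1 + c2eval e2
  | C2mul e1 e2 => c2eval e1 * c2eval e2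
  end.

Lemma c2evalE e : c2eval e = c2sum (c2words e).
Proof.
rewrite /c2sum; elim: e => /= [||i|e1 -> e2 ->|e1 -> e2 ->].
- by rewrite big_nil.
- by rewrite big_seq1 /c2word big_nil.
- by rewrite big_seq1 /c2word big_seq1.
- by rewrite big_cat.
- rewrite big_allpairs_dep mulr_suml; apply: eq_bigr => u _.
  by rewrite mulr_sumr; apply: eq_bigr => v _; rewrite /c2word big_cat.
Qed.

Lemma c2sum_reduce s : c2sum (c2reduce s) = c2sum s.
Proof.
rewrite /c2sum; elim: s => //= w s IH; rewrite big_cons -IH /c2toggle.
case: ifP => [ws|_]; last by rewrite big_cons.
by rewrite [in RHS](perm_big _ (perm_to_rem ws)) big_cons addrA char2 add0r.
Qed.

Lemma char2_eq (x y : R) : x + y = 0 -> x = y.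
Proof. by move=> e; rewrite -[x]addr0 -(char2 y) addrA e add0r. Qed.

Variable kill : pred (seq nat).
Hypothesis killE : forall w, kill w -> c2word w = 0.

(** Both sides expand to the same monomials, counted modulo 2 and up to those
    that [kill] discards. *)
Lemma c2_check e1 e2 :
  c2reduce [seq w <- c2words (C2add e1 e2) | ~~ kill w] = [::] ->
  c2eval e1 = c2eval e2.
Proof.
move=> e0; apply: char2_eq; rewrite -[LHS]/(c2eval (C2add e1 e2)) c2evalE.
rewrite /c2sum (bigID kill) /= big1 => [|w /killE //].
by rewrite add0r -big_filter -[LHS]/(c2sum _) -c2sum_reduce e0 /c2sum big_nil.
Qed.

End CharTwo.

Section CharTwoCom.
Local Open Scope ring_scope.
Variables (R : comPzRingType) (env : seq R).
Hypothesis char2 : forall x : R, x + x = 0.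

Lemma c2_check_com e1 e2 :
  c2reduce [seq sort leq w | w <- c2words (C2add e1 e2)] = [::] ->
  c2eval env e1 = c2eval env e2.
Proof.
move=> e0; apply: char2_eq => //; rewrite -[LHS]/(c2eval env (C2add e1 e2)).
rewrite c2evalE.
transitivity (c2sum env [seq sort leq w | w <- c2words (C2add e1 e2)]).
  rewrite /c2sum big_map; apply: eq_bigr => w _.
  by apply: perm_big; rewrite perm_sym perm_sort.
by rewrite -c2sum_reduce // e0 /c2sum big_nil.
Qed.

End CharTwoCom.

Ltac c2_atom env t :=
  lazymatch env with
  | cons t _ => constr:(O)
  | cons _ ?env' => let n := c2_atom env' t in constr:(S n)
  end.

Ltac c2_reify env t :=
  lazymatch t with
  | @GRing.add _ ?x ?y =>
    let a := c2_reify env x in let b := c2_reify env y in constr:(C2add a b)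
  | @GRing.mul _ ?x ?y =>
    let a := c2_reify env x in let b := c2_reify env y in constr:(C2mul a b)
  | @GRing.zero _ => constr:(C2zero)
  | @GRing.one _ => constr:(C2one)
  | _ => let n := c2_atom env t in constr:(C2atom n)
  end.

Ltac c2_mem env t :=
  lazymatch env with
  | nil => constr:(false)
  | cons t _ => constr:(true)
  | cons _ ?env' => c2_mem env' t
  end.

Ltac c2_atoms env t :=
  lazymatch t with
  | @GRing.add _ ?x ?y => let env' := c2_atoms env x in c2_atoms env' y
  | @GRing.mul _ ?x ?y => let env' := c2_atoms env x in c2_atoms env' y
  | @GRing.zero _ => env
  | @GRing.one _ => env
  | _ => lazymatch c2_mem env t with
         | true => env
         | false => constr:(cons t env)
         end
  end.

(** Proves an identity of commutative polynomials over the field with two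
    elements. *)
Ltac char2_ring char2 :=
  lazymatch goal with |- @eq ?T ?x ?y =>
    let env := c2_atoms (@nil T) x in
    let env := c2_atoms env y in
    let a := c2_reify env x in let b := c2_reify env y in
    refine (@c2_check_com _ env char2 a b _); vm_compute; reflexivity
  end.

(** Proves an identity of noncommutative polynomials in the atoms [env], up to
    the monomials that [kill] recognises and [killE] proves to vanish. *)
Ltac char2_nc char2 env killE :=
  lazymatch goal with |- @eq ?T ?x ?y =>
    let a := c2_reify env x in let b := c2_reify env y in
    refine (@c2_check _ env char2 _ killE a b _); vm_compute; reflexivity
  end.

(** * Sandwiches between unipotent elements *)

Section UnipotentWords.
Local Open Scope ring_scope.
Variables (R : pzRingType).

Definition udword (U D : R) (s : seq bool) : R :=
  \prod_(b <- s) (if b then U else D).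

Definition udseq (s : seq nat) := map (eq_op 0) s.

Lemma udwordE (U D Y : R) (s : seq nat) : all (gtn 2) s ->
  c2word [:: U; D; Y] s = udword U D (udseq s).
Proof.
rewrite /c2word /udword /udseq big_map => /allP s2; apply: eq_big_seq => i /s2.
by case: i => [|[|]].
Qed.

(** Recognises the monomials with a factor [U * U] before the first [Y]; the
    atoms are numbered [U], [D], [Y]. *)
Definition uu_before (w : seq nat) :=
  let p := take (index 2 w) w in
  [&& 2 \in w, all (gtn 2) p & infix [:: 0; 0] p].

Lemma uu_beforeE (U D Y : R) w :
  (forall s, U * U * udword U D s * Y = 0) ->
  uu_before w -> c2word [:: U; D; Y] w = 0.
Proof.
move=> UUY /and3P[w2 all2 /infixP[p [q pq]]].
rewrite -(cat_take_drop (index 2 w) w) (drop_nth 0) ?index_mem // nth_index //.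
move: all2; rewrite pq !all_cat => /and3P[_ _ q2].
rewrite /c2word !big_cat !big_cons /= ?big_nil mulr1.
rewrite -[\prod_(i <- q) _]/(c2word _ q) (udwordE _ _ _ q2).
by rewrite mulrA -(mulrA (\prod_(i <- p) _)) UUY mulr0 mul0r.
Qed.

Definition uu_after (w : seq nat) :=
  let q := drop (index 2 w).+1 w in
  [&& 2 \in w, all (gtn 2) q & infix [:: 0; 0] q].

Lemma uu_afterE (U D Y : R) w :
  (forall s, Y * udword U D s * (U * U) = 0) ->
  uu_after w -> c2word [:: U; D; Y] w = 0.
Proof.
move=> YUU /and3P[w2 all2 /infixP[p [q pq]]].
rewrite -(cat_take_drop (index 2 w) w) (drop_nth 0) ?index_mem // nth_index //.
move: all2; rewrite pq !all_cat => /and3P[p2 _ _].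
rewrite /c2word !big_cat !big_cons /= !big_cat /= !big_cons.
rewrite -[\prod_(i <- p) _]/(c2word _ p) (udwordE _ _ _ p2).
by rewrite (mulrA U) (mulrA (udword _ _ _)) (mulrA Y) (mulrA Y) YUU mul0r mulr0.
Qed.

(** Disposes of the words with a short vanishing factor, such as [D * D * D]. *)
Lemma c2word_infix (env : seq R) v w :
  c2word env v = 0 -> infix v w -> c2word env w = 0.
Proof.
move=> v0 /infixP[p [q ->]]; rewrite /c2word !big_cat /=.
by rewrite -[X in _ * (X * _)]/(c2word env v) v0 mul0r mulr0.
Qed.

End UnipotentWords.

Section UnipotentAnnihilator.
Local Open Scope ring_scope.
Variables (R : pzRingType) (U D Y : R).
Hypothesis char2 : forall x : R, x + x = 0.
Hypothesis UUY : forall s, U * U * udword U D s * Y = 0.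
Hypothesis D3 : D * D * D = 0.
Hypothesis UD3 : (U + D + U * D) * (U + D + U * D) * (U + D + U * D) = 0.

Let kill w := uu_before w || infix [:: 1; 1; 1] w.

Let killE w : kill w -> c2word [:: U; D; Y] w = 0.
Proof.
case/orP; first exact: uu_beforeE.
apply: c2word_infix.
by rewrite /c2word !big_cons big_nil /= mulr1 mulrA.
Qed.

(** With [U = u - 1] and [D = d - 1], the cube is that of [u * d - 1].  Multiplied
    by [u] on the left and by the inverse of [d] on the right, it keeps only one
    term that is not linear in [U], as the words with a factor [U * U] before [Y]
    vanish.  The element [Y] varies: the equation is also used for [D * Y]. *)
Lemma sandwich_equation :
  (D * D * U + D * U * D + U * D * D) * Y + (1 + D) * U * D * U * Y = 0.
Proof.
transitivity ((1 + U) *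
  ((U + D + U * D) * (U + D + U * D) * (U + D + U * D)) * (1 + D + D * D) * Y).
  by char2_nc char2 [:: U; D; Y] killE.
by rewrite UD3 mulr0 !mul0r.
Qed.

End UnipotentAnnihilator.

Section UnipotentAnnihilator2.
Local Open Scope ring_scope.
Variables (R : pzRingType) (U D Y : R).
Hypothesis char2 : forall x : R, x + x = 0.
Hypothesis UUY : forall s, U * U * udword U D s * Y = 0.
Hypothesis D3 : D * D * D = 0.
Hypothesis UD3 : (U + D + U * D) * (U + D + U * D) * (U + D + U * D) = 0.
Hypothesis UDD3 : (U + D * D + U * (D * D)) * (U + D * D + U * (D * D)) *
  (U + D * D + U * (D * D)) = 0.

Let kill w := uu_before w || infix [:: 1; 1; 1] w.

Let killE w : kill w -> c2word [:: U; D; Y] w = 0.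
Proof.
case/orP; first exact: uu_beforeE.
apply: c2word_infix.
by rewrite /c2word !big_cons big_nil /= mulr1 mulrA.
Qed.

Let eqY := sandwich_equation char2 UUY D3 UD3.

Let eqDY :
  (D * D * U + D * U * D + U * D * D) * (D * Y) +
    (1 + D) * U * D * U * (D * Y) = 0.
Proof.
apply: sandwich_equation => // s; rewrite mulrA -(mulrA (U * U)).
have := UUY (rcons s false); rewrite /udword -cats1 big_cat big_seq1 /=.
by rewrite !mulrA.
Qed.

(** The same equation for [u * d ^+ 2]. *)
Let eqDDY : D * D * U * D * D * Y + (1 + D * D) * U * D * D * U * Y = 0.
Proof.
transitivity ((1 + U) * ((U + D * D + U * (D * D)) * (U + D * D + U * (D * D)) *
  (U + D * D + U * (D * D))) * (1 + D * D) * Y); last first.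
  by rewrite UDD3 mulr0 !mul0r.
by char2_nc char2 [:: U; D; Y] killE.
Qed.

(** Compare [D] times the equation for [Y] with the equation for [D * Y]. *)
Let comDF : D * U * D * U * Y + U * D * U * D * Y = 0.
Proof.
transitivity ((1 + D + D * D) * (D * ((D * D * U + D * U * D + U * D * D) * Y +
  (1 + D) * U * D * U * Y) + ((D * D * U + D * U * D + U * D * D) * (D * Y) +
    (1 + D) * U * D * U * (D * Y)))); first by char2_nc char2 [:: U; D; Y] killE.
by rewrite eqY eqDY mulr0 addr0 mulr0.
Qed.

(** With [F = U * D * U]: the other terms are eliminated between the equations for
    [u * d] and [u * d ^+ 2], given that [D * F] and [F * D] agree on [Y]. *)
Lemma sandwich_left : D * U * D * U * Y = 0.
Proof.
transitivity ((1 + D + D * D) * (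
  D * D * ((D * D * U + D * U * D + U * D * D) * Y + (1 + D) * U * D * U * Y)
  + (D * D * U * D * D * Y + (1 + D * D) * U * D * D * U * Y)
  + (1 + D * D) * U * ((D * D * U + D * U * D + U * D * D) * Y +
                       (1 + D) * U * D * U * Y)
  + (1 + D * D) * (1 + U) * (D * U * D * U * Y + U * D * U * D * Y)));
  last by rewrite eqY eqDDY comDF !mulr0 !addr0 mulr0.
by char2_nc char2 [:: U; D; Y] killE.
Qed.

Lemma sandwich_right : U * D * U * D * Y = 0.
Proof. by have := comDF; rewrite sandwich_left add0r. Qed.

End UnipotentAnnihilator2.

Section UnipotentSandwich.
Local Open Scope ring_scope.
Variable R : pzRingType.
Hypothesis char2 : forall x : R, x + x = 0.

(** If [G * G * G = 0], this is the part linear in [X] of [(G + X + G * X) ^+ 3], up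
    to the unit factor [1 + G]. *)
Definition sqsum (G X : R) := G * G * X + G * X * G + X * G * G.

Section Half.
Variables U D W : R.
Hypothesis UUW : forall s, U * U * udword U D s * W = 0.
Hypothesis WUU : forall s, W * udword U D s * (U * U) = 0.
Hypothesis D3 : D * D * D = 0.
Hypothesis UWU : U * W * U = 0.
Hypothesis UD3 : (U + D + U * D) * (U + D + U * D) * (U + D + U * D) = 0.
Hypothesis UDD3 : (U + D * D + U * (D * D)) * (U + D * D + U * (D * D)) *
  (U + D * D + U * (D * D)) = 0.
Let X := U * W + W * U.
Let G := U + D + U * D.
Hypotheses (DW : sqsum D W = 0) (DX : sqsum D X = 0).
Hypotheses (GW : sqsum G W = 0) (GX : sqsum G X = 0).

Let kill w := [|| uu_before w, uu_after w, infix [:: 1; 1; 1] w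
  | infix [:: 0; 2; 0] w].

Let killE w : kill w -> c2word [:: U; D; W] w = 0.
Proof.
case/or4P; [exact: uu_beforeE|exact: uu_afterE| |];
  by apply: c2word_infix; rewrite /c2word !big_cons big_nil /= mulr1 mulrA.
Qed.

Let UUX s : U * U * udword U D s * X = 0.
Proof.
have := UUW (rcons s true); rewrite /udword -cats1 big_cat big_seq1 /=.
by rewrite /X mulrDr !mulrA => ->; rewrite UUW mul0r addr0.
Qed.

(** The linear parts in [W] and in [X] of the cubes attached to [d] and [u * d]
    move [W] across [F = U * D * U]; here [X] is the increment from [w] to its
    conjugate by [u]. *)
Lemma sandwich_slide : U * D * U * W * D + W * U * D * U * (1 + D) = 0.
Proof.
transitivity (((D * D * U + D * U * D + U * D * D) * X +
    (1 + D) * U * D * U * X) + (1 + U) * (sqsum G X + sqsum D X) +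
    U * (sqsum G W + sqsum D W) + U * D * U * D * W).
  by rewrite /sqsum /X /G; char2_nc char2 [:: U; D; W] killE.
rewrite (sandwich_equation char2 UUX D3 UD3) GX DX GW DW !addr0 !mulr0 !add0r.
exact: sandwich_right.
Qed.

End Half.
End UnipotentSandwich.

Section UnipotentSandwichVanish.
Local Open Scope ring_scope.
Variable R : pzRingType.
Hypothesis char2 : forall x : R, x + x = 0.
Variables U D W : R.
Hypothesis UUW : forall s, U * U * udword U D s * W = 0.
Hypothesis WUU : forall s, W * udword U D s * (U * U) = 0.
Hypothesis UWU : U * W * U = 0.
Let X := U * W + W * U.

(** [G] runs over [g - 1] for [g = d], [u * d], [d * u], [u * d ^+ 2] and
    [d ^+ 2 * u], where [U = u - 1] and [D = d - 1]. *)
Hypothesis cube : forall G, G \in [:: D; U + D + U * D; U + D + D * U;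
  U + D * D + U * (D * D); U + D * D + D * D * U] -> G * G * G = 0.
Hypothesis sqsumW : forall G, G \in [:: D; U + D + U * D; U + D + D * U] ->
  sqsum G W = 0.
Hypothesis sqsumX : forall G, G \in [:: D; U + D + U * D; U + D + D * U] ->
  sqsum G X = 0.

Let nokill (env : seq R) (w : seq nat) : false -> c2word env w = 0.
Proof. by []. Qed.

Let converse (Y G : R) : sqsum G Y = 0 -> sqsum (R := R^c) G Y = 0.
Proof.
move=> e; rewrite -[RHS]e.
have -> : sqsum (R := R^c) G Y = Y * (G * G) + G * (Y * G) + G * (G * Y) by [].
by rewrite /sqsum; char2_nc char2 [:: G; Y] (nokill [:: G; Y]).
Qed.

Let converse_cube (G : R) : G * G * G = 0 -> (G : R^c) * G * G = 0.
Proof. by rewrite -mulrA. Qed.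

Let converse_word (V E : R) s : udword (R := R^c) V E s = udword V E (rev s).
Proof.
rewrite /udword; elim: s => [|b s IH]; first by rewrite !big_nil.
by rewrite rev_cons -cats1 big_cat big_seq1 big_cons IH.
Qed.

(** With [F = U * D * U], the slide and [D * F * W = 0] give [D * W * F = 0], and
    the slide in the converse ring then leaves [(1 + D) * F * W = 0], where
    [1 + D] is a unit. *)
Lemma sandwich_vanish : U * D * U * W = 0.
Proof.
have slide : U * D * U * W * D + W * U * D * U * (1 + D) = 0.
  by apply: sandwich_slide => //; rewrite ?cube ?sqsumW ?sqsumX ?inE ?eqxx ?orbT.
have left0 : D * U * D * U * W = 0.
  by apply: sandwich_left => //; rewrite cube ?inE ?eqxx ?orbT.
have slide' : D * (W * (U * (D * U))) + (1 + D) * (U * (D * (U * W))) = 0.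
  have UDc : (U : R^c) + D + (U : R^c) * D = U + D + D * U by [].
  have DDc : (U : R^c) + (D : R^c) * D + (U : R^c) * ((D : R^c) * D) =
    U + D * D + D * D * U by [].
  apply: (@sandwich_slide R^c char2 U D W) => [s|s||||||||].
  - rewrite converse_word -[LHS]/(W * (udword U D (rev s) * (U * U))) mulrA.
    exact: WUU.
  - rewrite converse_word -[LHS]/(U * U * (udword U D (rev s) * W)) mulrA.
    exact: UUW.
  - by apply: converse_cube; rewrite cube ?inE ?eqxx.
  - by rewrite -[LHS]/(U * (W * U)) mulrA.
  - by rewrite UDc; apply: converse_cube; rewrite cube ?inE ?eqxx ?orbT.
  - by rewrite DDc; apply: converse_cube; rewrite cube ?inE ?eqxx ?orbT.
  - by apply: converse; rewrite sqsumW ?inE ?eqxx ?orbT.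
  - have -> : (U : R^c) * W + (W : R^c) * U = X by rewrite /X addrC.
    by apply: converse; rewrite sqsumX ?inE ?eqxx ?orbT.
  - by rewrite UDc; apply: converse; rewrite sqsumW ?inE ?eqxx ?orbT.
  - have -> : (U : R^c) * W + (W : R^c) * U = X by rewrite /X addrC.
    by rewrite UDc; apply: converse; rewrite sqsumX ?inE ?eqxx ?orbT.
have right0 : D * W * U * D * U * (1 + D) = 0.
  transitivity (D * (U * D * U * W * D + W * U * D * U * (1 + D)) +
    D * U * D * U * W * D); last by rewrite slide left0 mulr0 mul0r addr0.
  by char2_nc char2 [:: U; D; W] (nokill [:: U; D; W]).
have D3 : D * D * D = 0 by rewrite cube ?inE ?eqxx.
have dK : (1 + D) * (1 + D + D * D) = 1.
  rewrite -[RHS]addr0 -D3.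
  by char2_nc char2 [:: D] (nokill [:: D]).
have Kd : (1 + D + D * D) * (1 + D) = 1.
  rewrite -[RHS]addr0 -D3.
  by char2_nc char2 [:: D] (nokill [:: D]).
have {}right0 : D * W * U * D * U = 0.
  by rewrite -[LHS]mulr1 -dK mulrA right0 mul0r.
move: slide'; rewrite !mulrA right0 add0r => slide'.
rewrite -[LHS]mul1r -Kd -mulrA.
by rewrite !mulrA in slide' *; rewrite -!mulrA in slide' *; rewrite slide' mulr0.
Qed.
End UnipotentSandwichVanish.

(** * The endomorphism ring of an abelian group *)

Section Endomorphisms.
Local Open Scope group_scope.
Variable M : groupType.

Record endo := Endo { endo_fun :> M -> M; endoM : {morph endo_fun : x y / x * y} }.

HB.instance Definition _ := gen_eqMixin endo.
HB.instance Definition _ := gen_choiceMixin endo.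

Lemma endo_eq (f g : endo) : f =1 g -> f = g.
Proof.
case: f g => [f fM] [g gM] /= /funext e; move: fM gM; rewrite e => fM gM.
by congr Endo; apply: Prop_irrelevance.
Qed.

Hypothesis abM : forall x y : M, x * y = y * x.

(** The commutativity of [M] is an argument, so that it is found in the type by
    the ring structure. *)
Definition endo_ring (_ : forall x y : M, x * y = y * x) := endo.

Fact endo_add_subproof (f g : endo) : {morph (fun x => f x * g x) : x y / x * y}.
Proof. by move=> x y; rewrite !endoM !mulgA -(mulgA (f x)) (abM (f y)) !mulgA. Qed.
Definition endo_add (f g : endo) := Endo (endo_add_subproof f g).

Fact endo_opp_subproof (f : endo) : {morph (fun x => (f x)^-1) : x y / x * y}.
Proof. by move=> x y; rewrite endoM invgM abM. Qed.
Definition endo_opp (f : endo) := Endo (endo_opp_subproof f).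

Fact endo_zero_subproof : {morph (fun _ : M => 1 : M) : x y / x * y}.
Proof. by move=> x y; rewrite mulg1. Qed.
Definition endo_zero := Endo endo_zero_subproof.

Fact endo_one_subproof : {morph (fun x : M => x) : x y / x * y}.
Proof. by []. Qed.
Definition endo_one := Endo endo_one_subproof.

(** Endomorphisms act on the right, like conjugation. *)
Fact endo_mul_subproof (f g : endo) : {morph (fun x => g (f x)) : x y / x * y}.
Proof. by move=> x y; rewrite !endoM. Qed.
Definition endo_mul (f g : endo) := Endo (endo_mul_subproof f g).

HB.instance Definition _ := Choice.on (endo_ring abM).

Fact endo_addA : associative endo_add.
Proof. by move=> f g h; apply: endo_eq => x /=; rewrite mulgA. Qed.
Fact endo_addC : commutative endo_add.
Proof. by move=> f g; apply: endo_eq => x /=; rewrite abM. Qed.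
Fact endo_add0 : left_id endo_zero endo_add.
Proof. by move=> f; apply: endo_eq => x /=; rewrite mul1g. Qed.
Fact endo_addN : left_inverse endo_zero endo_opp endo_add.
Proof. by move=> f; apply: endo_eq => x /=; rewrite mulVg. Qed.
Fact endo_mulA : associative endo_mul.
Proof. by move=> f g h; apply: endo_eq. Qed.
Fact endo_mul1 : left_id endo_one endo_mul.
Proof. by move=> f; apply: endo_eq. Qed.
Fact endo_mulr1 : right_id endo_one endo_mul.
Proof. by move=> f; apply: endo_eq. Qed.
Fact endo_mulDl : left_distributive endo_mul endo_add.
Proof. by move=> f g h; apply: endo_eq => x /=; rewrite endoM. Qed.
Fact endo_mulDr : right_distributive endo_mul endo_add.
Proof. by move=> f g h; apply: endo_eq. Qed.

HB.instance Definition _ := GRing.isPzRing.Build (endo_ring abM)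
  endo_addA endo_addC endo_add0 endo_addN endo_mulA endo_mul1 endo_mulr1
  endo_mulDl endo_mulDr.

End Endomorphisms.

(** * Engel elements and normal closures *)

Section EngelClosures.
Local Open Scope classical_set_scope.
Local Open Scope group_scope.
Variable K : groupType.
Implicit Types a b g k r x y : K.

Lemma left_2Engel_commuteJ a g : left_2Engel a -> commute a (a ^ g).
Proof.
move=> /(_ g)/eqP/commgP/commute_sym; rewrite commgEr => c.
have : commute a (a^-1 ^ g * a * a^-1).
  by apply: commuteM => //; apply: commuteV.
by rewrite mulgK conjVg => /commuteV; rewrite invgK.
Qed.

Lemma commute_conj x y g : commute x y -> commute (x ^ g) (y ^ g).
Proof. by move=> c; rewrite /commute -!conjMg c. Qed.

(** The centraliser of a normal subset is normal. *)
Lemma normal_closure_abelian a : (forall g, commute a (a ^ g)) ->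
  abelian_set (normal_closure [set a]).
Proof.
move=> aP; set A := normal_closure _.
have centN (B : set K) : (forall x g, B x -> B (x ^ g)) ->
    is_normal_subgroup [set x | forall y, B y -> commute x y].
  move=> BJ; split; [split|] => /=.
  - by move=> y _; apply/commute_sym/commute1.
  - move=> x y xB yB z Bz; apply/commute_sym/commuteM; first exact/commute_sym/xB.
    by apply/commuteV/commute_sym/yB.
  - move=> x g xB y By; rewrite -[y](conjgKV g).
    by apply/commute_conj/xB/BJ.
have AJ x g : A x -> A (x ^ g).
  by have [_] := normal_closure_normal [set a]; apply.
have cA y : A y -> commute a y.
  move=> Ay; apply/commute_sym; pose C := [set b | exists g, b = a ^ g].
  have CJ x g : C x -> C (x ^ g) by case=> h ->; exists (h * g); rewrite conjgM.
  have : A `<=` [set x | forall y, C y -> commute x y].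
    by apply: smallest_sub => [|_ -> _ [g ->]]; [exact: centN | exact: aP].
  by move/(_ y Ay a); apply; exists 1; rewrite conjg1.
have sub : A `<=` [set x | forall y, A y -> commute x y].
  by apply: smallest_sub => [|_ ->]; [exact: centN AJ | exact: cA].
by move=> x y Ax Ay; apply: sub.
Qed.

Lemma left_2Engel_closure_abelian a : left_2Engel a ->
  abelian_set (normal_closure [set a]).
Proof.
by move=> aE; apply: normal_closure_abelian => g; apply: left_2Engel_commuteJ.
Qed.

Lemma normal_closure_exponent2 a : a ^+ 2 = 1 ->
  abelian_set (normal_closure [set a]) ->
  forall x, normal_closure [set a] x -> x ^+ 2 = 1.
Proof.
move=> a2 abA; set A := normal_closure _ in abA *.
have [gA AJ] := normal_closure_normal [set a].
have sub : A `<=` [set x | A x /\ x ^+ 2 = 1].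
  apply: smallest_sub => [|_ ->]; last by split=> // B [_]; apply.
  split; [split=> [|x y [Ax x2] [Ay y2]]|move=> x g [Ax x2]]; split.
  - exact: gA.1.
  - by rewrite expg1n.
  - exact: gA.2.
  - rewrite expgMn; last by apply: abA => //; apply: (is_subgroupV gA).
    by rewrite expVgn x2 y2 invg1 mulg1.
  - exact: AJ.
  - by rewrite -conjXg x2 conj1g.
by move=> x /sub[].
Qed.

(** On the normal closure of [r], which is elementary abelian, [y - 1] has square
    [y ^+ 2 - 1]. *)
Lemma right_2Engel_commute_square r y : right_2Engel r -> r ^+ 2 = 1 ->
  commute r (y ^+ 2).
Proof.
move=> rP r2; apply/commgP/eqP; rewrite expgS expg1 commgMr.
have rV : r^-1 = r by apply: (mulgI r); rewrite mulgV -r2 expgS expg1.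
have -> : [~ r, y] ^ y = [~ r, y].
  by apply/conjg_fixP/commgP/right_2Engel_commute.
have c := right_2Engel_commuteJ y rP.
rewrite commgEl rV -[LHS]/((r * r ^ y) ^+ 2) expgMn // r2 mul1g.
by rewrite -conjXg r2 conj1g.
Qed.

End EngelClosures.

(** * Conjugation on an elementary abelian normal subgroup *)

Section CharTwoPowers.
Local Open Scope ring_scope.
Variable R : pzRingType.
Hypothesis char2 : forall x : R, x + x = 0.

Let nokill (env : seq R) (w : seq nat) : false -> c2word env w = 0.
Proof. by []. Qed.

Lemma cube_subr1 (c : R) : c * c * c + c * c + c + 1 = 0 ->
  (c + 1) * (c + 1) * (c + 1) = 0.
Proof.
move=> <-; by char2_nc char2 [:: c] (nokill [:: c]).
Qed.

(** Multiplying the cube by the inverse [1 + G + G * G] of [1 + G] isolates its part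
    linear in [W]. *)
Lemma sqsum_cube (G W : R) :
  G * G * G = 0 -> W * W = 0 -> W * G * W = 0 -> W * G * G * W = 0 ->
  ((1 + G) * (1 + W) + 1) * ((1 + G) * (1 + W) + 1) * ((1 + G) * (1 + W) + 1)
    = 0 ->
  sqsum G W = 0.
Proof.
move=> G3 WW WGW WGGW e.
pose kill (w : seq nat) := [|| infix [:: 0; 0; 0]%N w, infix [:: 1; 1]%N w,
  infix [:: 1; 0; 1]%N w | infix [:: 1; 0; 0; 1]%N w].
have killE w : kill w -> c2word [:: G; W] w = 0.
  by case/or4P; apply: c2word_infix; rewrite /c2word !big_cons big_nil /= mulr1
    ?mulrA.
transitivity ((1 + G + G * G) * (((1 + G) * (1 + W) + 1) *
  ((1 + G) * (1 + W) + 1) * ((1 + G) * (1 + W) + 1))); last by rewrite e mulr0.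
by rewrite /sqsum; char2_nc char2 [:: G; W] killE.
Qed.

End CharTwoPowers.

Section Conjugation.
Local Open Scope classical_set_scope.
Local Open Scope group_scope.
Variables (K : groupType) (N : subgroup K).
Hypothesis NJ : forall x g : K, (N : set K) x -> (N : set K) (x ^ g).
Hypothesis abN : abelian_set N.
Hypothesis N2 : forall x : K, (N : set K) x -> x ^+ 2 = 1.
Hypothesis exp4 : forall x : K, x ^+ 4 = 1.

Let M := subgroup_type N.

Let valN (m : M) : (N : set K) (val m). Proof. exact/set_mem/(valP m). Qed.

Lemma subgroup_type_abelian (x y : M) : x * y = y * x.
Proof. by apply: val_inj => /=; apply: abN; apply: valN. Qed.

Notation E := (endo_ring subgroup_type_abelian).

Fact conj_endo_subproof1 (g : K) (m : M) : val m ^ g \in (N : set K).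
Proof. exact/mem_set/NJ. Qed.
Definition conj_endo_fun (g : K) (m : M) : M := Sub (val m ^ g) (conj_endo_subproof1 g m).
Fact conj_endo_subproof2 (g : K) : {morph conj_endo_fun g : x y / x * y}.
Proof. by move=> x y; apply: val_inj => /=; rewrite conjMg. Qed.
Definition conj_endo (g : K) : E := Endo (conj_endo_subproof2 g).

Local Open Scope ring_scope.

Lemma conj_endoM g h : conj_endo (g * h)%g = conj_endo g * conj_endo h.
Proof.
apply: endo_eq => m; apply: val_inj => /=; exact: conjgM.
Qed.

Lemma conj_endo1 : conj_endo 1%g = 1.
Proof. by apply: endo_eq => m; apply: val_inj; rewrite /= conjg1. Qed.

Lemma endo_char2 (f : E) : f + f = 0.
Proof. by apply: endo_eq => m; apply: val_inj; exact: (N2 (valN (f m))). Qed.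

(** Since [g ^+ 4] and [(g * x) ^+ 4] are trivial, so is the product of the
    conjugates of [x] under [1], [g], [g ^+ 2] and [g ^+ 3]. *)
Lemma conj_endo_cube g : (conj_endo g + 1) * (conj_endo g + 1) * (conj_endo g + 1) = 0.
Proof.
apply: cube_subr1; first exact: endo_char2.
apply: endo_eq => m; apply: val_inj => /=; set x := sval m.
have e : (g ^- 4 * (g * x) ^+ 4 = 1)%g by rewrite !exp4 invg1 mulg1.
rewrite -[RHS]e /conjg !expgS expg0 !invgM !mulgA !mulg1 !mulgK !mulgVK.
by rewrite invg1 !mul1g.
Qed.

Let char2 : forall f : E, f + f = 0 := endo_char2.

Let nokill (env : seq E) (w : seq nat) : false -> c2word env w = 0.
Proof. by []. Qed.

Let addK1 (f : E) : 1 + (f + 1) = f.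
Proof. by char2_nc char2 [:: f] (nokill [:: f]). Qed.

(** The image of [w - 1] consists of products of conjugates of [w], and these
    commute with [w]. *)
Lemma conj_endo_sandwich (w k : K) : left_2Engel w ->
  (conj_endo w + 1) * conj_endo k * (conj_endo w + 1) = 0.
Proof.
move=> wP; apply: endo_eq => m; apply: val_inj => /=; set x := sval m.
have Nx : (N : set K) x by exact: valN.
have Ny : (N : set K) ((x ^ w * x) ^ k)%g.
  by apply: NJ; apply: (is_subgroupM (subgroupP N)) => //; apply: NJ.
have xV : x^-1%g = x by apply: (mulgI x); rewrite mulgV -(N2 Nx) expgS expg1.
have -> : (((x ^ w * x) ^ k) ^ w = (x ^ w * x) ^ k)%g.
  apply/conjg_fixP/commgP/commute_sym.
  have -> : (x ^ w * x = w^-1 * w ^ x^-1)%g by rewrite /conjg invgK !mulgA xV.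
  rewrite conjMg conjVg -conjgM; apply: commuteM; first apply: commuteV;
  exact: left_2Engel_commuteJ.
by have := N2 Ny; rewrite expgS expg1.
Qed.

(** This is the part linear in [w - 1] of the cube of [g * w - 1]. *)
Lemma conj_endo_sqsum (g w : K) : left_2Engel w ->
  sqsum (conj_endo g + 1) (conj_endo w + 1) = 0.
Proof.
move=> wP; have s1 k := conj_endo_sandwich k wP.
set G := _ + 1; set W := _ + 1 in s1 *.
have WW : W * W = 0 by have := s1 1%g; rewrite conj_endo1 mulr1.
apply: sqsum_cube => //.
- exact: conj_endo_cube.
- have -> : W * G * W = W * conj_endo g * W + W * W.
    by rewrite /G; char2_nc char2 [:: conj_endo g; W] (nokill [:: conj_endo g; W]).
  by rewrite s1 WW addr0.
- have -> : W * G * G * W = W * conj_endo (g * g)%g * W + W * W.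
    by rewrite conj_endoM /G; char2_nc char2 [:: conj_endo g; W]
      (nokill [:: conj_endo g; W]).
  by rewrite s1 WW addr0.
- by rewrite /G /W !addK1 -conj_endoM; apply: conj_endo_cube.
Qed.

Section SandwichCommutator.
Variables u d w : K.
Hypothesis u2 : right_2Engel (u ^+ 2)%g.
Hypothesis wP : left_2Engel w.
Hypothesis commute_w : forall r : K, right_2Engel r -> (r ^+ 2 = 1)%g -> commute r w.

Let U := conj_endo u + 1.
Let D := conj_endo d + 1.
Let W := conj_endo w + 1.

Let t2 : ((u ^+ 2) ^+ 2 = 1)%g. Proof. by rewrite -expgnA; apply: exp4. Qed.

Let UU : U * U = conj_endo (u ^+ 2)%g + 1.
Proof.
by rewrite expgS expg1 conj_endoM /U; char2_nc char2 [:: conj_endo u]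
  (nokill [:: conj_endo u]).
Qed.

Let invN x : (N : set K) x -> (x^-1 = x)%g.
Proof. by move=> Nx; apply: (mulgI x); rewrite mulgV -(N2 Nx) expgS expg1. Qed.

(** [U * U = u ^+ 2 - 1] takes its values among the right 2-Engel elements. *)
Let UUkW k : U * U * conj_endo k * W = 0.
Proof.
rewrite UU; apply: endo_eq => m; apply: val_inj => /=; set x := sval m.
have Nx : (N : set K) x by exact: valN.
have Ny : (N : set K) ((x ^ (u ^+ 2) * x) ^ k)%g.
  by apply: NJ; apply: (is_subgroupM (subgroupP N)) => //; apply: NJ.
have yP : right_2Engel ((x ^ (u ^+ 2) * x) ^ k)%g.
  apply: right_2EngelJ; have -> : (x ^ (u ^+ 2) * x =
      (u ^+ 2)^-1 * (u ^+ 2) ^ x^-1)%g.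
    by rewrite /conjg invgK !mulgA (invN Nx).
  by apply: right_2EngelM; [exact: right_2EngelV | exact: right_2EngelJ].
have -> : (((x ^ (u ^+ 2) * x) ^ k) ^ w = (x ^ (u ^+ 2) * x) ^ k)%g.
  by apply/conjg_fixP/commgP; apply: commute_w => //; exact: N2.
by have := N2 Ny; rewrite expgS expg1.
Qed.

(** [u ^+ 2] commutes with the conjugates of [w], and the values of [W] are
    products of these. *)
Let WkUU k : W * conj_endo k * (U * U) = 0.
Proof.
rewrite UU; apply: endo_eq => m; apply: val_inj => /=; set x := sval m.
have Nx : (N : set K) x by exact: valN.
have Ny : (N : set K) ((x ^ w * x) ^ k)%g.
  by apply: NJ; apply: (is_subgroupM (subgroupP N)) => //; apply: NJ.
have tw h : commute (u ^+ 2)%g (w ^ h)%g.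
  rewrite -[(u ^+ 2)%g](conjgKV h); apply/commute_conj/commute_w.
    exact: right_2EngelJ.
  by rewrite -conjXg t2 conj1g.
have -> : (((x ^ w * x) ^ k) ^ (u ^+ 2) = (x ^ w * x) ^ k)%g.
  apply/conjg_fixP/commgP/commute_sym.
  have -> : (x ^ w * x = w^-1 * w ^ x^-1)%g by rewrite /conjg invgK !mulgA (invN Nx).
  by rewrite conjMg conjVg -conjgM; apply: commuteM; first apply: commuteV.
by have := N2 Ny; rewrite expgS expg1.
Qed.

(** Words in [U] and [D] are sums of conjugations. *)
Let udword_span (P : E -> Prop) : (forall k, P (conj_endo k)) ->
  (forall f h, P f -> P h -> P (f + h)) -> forall s, P (udword U D s).
Proof.
move=> Pc PD s; suff: forall k, P (conj_endo k * udword U D s).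
  by move/(_ 1%g); rewrite conj_endo1 mul1r.
elim: s => [|b s IH] k; first by rewrite /udword big_nil mulr1.
rewrite {1}/udword big_cons -/(udword U D s); case: b;
  rewrite ?/U ?/D mulrA mulrDr mulr1 mulrDl -conj_endoM;
  exact: PD.
Qed.

Let conj_wu : conj_endo (w ^ u)%g + 1 = W + (U * W + W * U).
Proof.
have UUW := UUkW 1%g; rewrite conj_endo1 mulr1 in UUW.
have WUU := WkUU 1%g; rewrite conj_endo1 mulr1 in WUU.
have UWU : U * W * U = 0.
  have := conj_endo_sqsum u wP; rewrite -/U -/W /sqsum UUW add0r.
  by rewrite -[W * U * U]mulrA WUU addr0.
have -> : (w ^ u = u ^+ 3 * (w * u))%g.
  rewrite /conjg; congr (_ * _)%g; apply: (mulgI u).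
  by rewrite mulgV -expgS exp4.
have cu : conj_endo u = U + 1 by rewrite /U addrC addK1.
have cw : conj_endo w = W + 1 by rewrite /W addrC addK1.
have U4 : U * U * U * U = 0.
  rewrite -mulrA UU; apply: (etrans _ (conj_endo_sandwich 1%g (_ : left_2Engel (u ^+ 2)%g))).
    by rewrite conj_endo1 mulr1.
  move=> x; apply/eqP/commgP; rewrite commgEr; apply/commute_sym/commuteM => //.
  by rewrite conjVg; apply/commuteV/right_2Engel_commuteJ.
rewrite !expgS expg0 mulg1 !conj_endoM cu cw.
pose kill (w : seq nat) := [|| infix [:: 0; 0; 1]%N w,
  infix [:: 0; 1; 0]%N w | infix [:: 0; 0; 0; 0]%N w].
have killE v : kill v -> c2word [:: U; W] v = 0.
  by case/or3P; apply: c2word_infix; rewrite /c2word !big_cons big_nil /= mulr1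
    ?mulrA.
by char2_nc char2 [:: U; W] killE.
Qed.

Lemma conj_endo_sandwich_vanish : U * D * U * W = 0.
Proof.
have cub g : (conj_endo g + 1) * (conj_endo g + 1) * (conj_endo g + 1) = 0.
  exact: conj_endo_cube.
have ud : conj_endo (u * d)%g + 1 = U + D + U * D.
  by rewrite conj_endoM /U /D; char2_nc char2 [:: conj_endo u; conj_endo d]
    (nokill [:: conj_endo u; conj_endo d]).
have du : conj_endo (d * u)%g + 1 = U + D + D * U.
  by rewrite conj_endoM /U /D; char2_nc char2 [:: conj_endo u; conj_endo d]
    (nokill [:: conj_endo u; conj_endo d]).
have udd : conj_endo (u * (d * d))%g + 1 = U + D * D + U * (D * D).
  by rewrite !conj_endoM /U /D; char2_nc char2 [:: conj_endo u; conj_endo d]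
    (nokill [:: conj_endo u; conj_endo d]).
have ddu : conj_endo (d * d * u)%g + 1 = U + D * D + D * D * U.
  by rewrite !conj_endoM /U /D; char2_nc char2 [:: conj_endo u; conj_endo d]
    (nokill [:: conj_endo u; conj_endo d]).
have UUW := UUkW 1%g; rewrite conj_endo1 mulr1 in UUW.
have WUU := WkUU 1%g; rewrite conj_endo1 mulr1 in WUU.
have sqX g : sqsum (conj_endo g + 1) (U * W + W * U) = 0.
  have e1 := conj_endo_sqsum g wP.
  have e2 : sqsum (conj_endo g + 1) (conj_endo (w ^ u)%g + 1) = 0.
    apply: conj_endo_sqsum => x; rewrite -[x](conjgKV u) -!conjRg wP.
    by rewrite conj1g.
  rewrite -[RHS]addr0 -[X in _ = _ + X]e1 -e2 conj_wu -/W; set G := _ + 1.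
  by rewrite /sqsum; char2_nc char2 [:: G; W; U] (nokill [:: G; W; U]).
apply: sandwich_vanish => //.
- move=> s; rewrite -mulrA; apply: (udword_span (P := fun f => _ * (f * W) = 0)).
    by move=> k; rewrite mulrA UUkW.
  by move=> f h e1 e2; rewrite [(f + h) * W]mulrDl [U * U * _]mulrDr e1 e2 addr0.
- move=> s; apply: (udword_span (P := fun f => W * f * _ = 0)) => [|f h e1 e2].
    exact: WkUU.
  by rewrite [W * (_ + _)]mulrDr mulrDl e1 e2 addr0.
- have := conj_endo_sqsum u wP; rewrite -/U -/W /sqsum UUW add0r.
  by rewrite -[W * U * U]mulrA WUU addr0.
- by move=> G; rewrite !inE -ud -du -udd -ddu => /or4P[|||/orP[]] /eqP ->; apply: cub.
- by move=> G; rewrite !inE -ud -du => /or3P[] /eqP ->; apply: conj_endo_sqsum.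
- by move=> G; rewrite !inE -ud -du => /or3P[] /eqP ->; apply: sqX.
Qed.

(** The vanishing of [U * d * U * W] in terms of elements, as [U] and [W] take
    commutators with [u] and [w]. *)
Lemma sandwich_commute x : (N : set K) x -> commute [~ [~ x, u]%g ^ d, u]%g w.
Proof.
move=> Nx; pose m : M := Sub x (mem_set Nx).
have e : U * conj_endo d * U * W = 0.
  have UUW := UUkW 1%g; rewrite conj_endo1 mulr1 in UUW.
  rewrite -[LHS]addr0 -[X in _ + X]UUW -conj_endo_sandwich_vanish /D.
  by char2_nc char2 [:: U; conj_endo d; W] (nokill [:: U; conj_endo d; W]).
have NR y : (N : set K) y -> (N : set K) [~ y, u]%g /\ [~ y, u]%g = (y ^ u * y)%g.
  move=> Ny; have Nyu := NJ u Ny.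
  have -> : [~ y, u]%g = (y ^ u * y)%g.
    by rewrite commgEl (invN Ny); apply: abN.
  by split=> //; apply: (is_subgroupM (subgroupP N)).
have [N1 e1] := NR x Nx; have [N2' e2] := NR _ (NJ d N1).
apply/commgP/conjg_fixP.
have := congr1 (fun f : E => val (f m)) e; rewrite /= -e1 -e2.
by move/(canRL (mulgK _)); rewrite mul1g (invN N2').
Qed.

End SandwichCommutator.

End Conjugation.

(** * Involutions modulo the right 2-Engel elements *)

Section Morphisms.
Local Open Scope group_scope.
Variables (G L : groupType) (f : G -> L).
Hypothesis fM : {morph f : x y / x * y}.

Lemma morphism1 : f 1 = 1.
Proof. by apply: (mulgI (f 1)); rewrite -fM !mulg1. Qed.

Lemma morphismV x : f x^-1 = (f x)^-1.
Proof. by apply: (mulgI (f x)); rewrite -fM !mulgV morphism1. Qed.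

Lemma morphismJ x y : f (x ^ y) = f x ^ f y.
Proof. by rewrite /conjg !fM morphismV. Qed.

Lemma morphismR x y : f [~ x, y] = [~ f x, f y].
Proof. by rewrite /commg fM morphismJ morphismV. Qed.

Lemma morphismX x n : f (x ^+ n) = f x ^+ n.
Proof. by elim: n => [|n IH]; rewrite ?morphism1 // !expgS fM IH. Qed.

End Morphisms.

Section LeftInduction.
Local Open Scope classical_set_scope.
Local Open Scope group_scope.

Lemma generated_sub (G : groupType) (S : set G) : S `<=` generated S.
Proof. by move=> x Sx B [_]; apply. Qed.

Lemma generated_morphism (G L : groupType) (f : G -> L) (S : set G) :
  {morph f : x y / x * y} -> (forall y, exists x, f x = y) ->
  generated S = setT -> generated (f @` S) = setT.
Proof.
move=> fM fsurj gS; rewrite -subTset => y _; have [x <-] := fsurj y.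
have [g1 gF] := generated_subgroup (f @` S).
have sub : generated S `<=` [set x | generated (f @` S) (f x)].
  apply: smallest_sub => [|z Sz]; last by apply: generated_sub; exists z.
  split=> [|a b /= fa fb]; first by rewrite /= (morphism1 fM).
  by rewrite fM (morphismV fM); apply: gF.
by apply: sub; rewrite gS.
Qed.

Lemma generated_left_ind (G : groupType) (S : set G) (P : G -> Prop) :
  P 1 -> (forall s y, S s -> P y -> P (s * y) /\ P (s^-1 * y)) ->
  forall x, generated S x -> P x.
Proof.
move=> P1 PS x Sx; suff: generated S `<=`
    [set x | forall y, P y -> P (x * y) /\ P (x^-1 * y)].
  by move/(_ x Sx 1 P1)=> []; rewrite mulg1.
apply: smallest_sub => [|s Ss y]; last exact: PS.
split=> [y Py|a b /= aP bP y Py]; first by rewrite invg1 mul1g.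
rewrite invgM invgK -!mulgA; split; first by have [] := aP _ (bP y Py).2.
by have [] := bP _ (aP y Py).2.
Qed.

End LeftInduction.

Section InvolutionGenerators.
Local Open Scope classical_set_scope.
Local Open Scope group_scope.
Variables (K : groupType) (S : set K).
Hypothesis genS : generated S = setT.
Hypothesis S2 : forall s, S s -> s ^+ 2 = 1.
Hypothesis SE : forall s, S s -> left_2Engel s.

Let SV s : S s -> s^-1 = s.
Proof. by move=> Ss; apply: (mulgI s); rewrite mulgV -(S2 Ss) expgS expg1. Qed.

Lemma involution_generators_ind (P : K -> Prop) :
  P 1 -> (forall s y, S s -> P y -> P (s * y)) -> forall x, P x.
Proof.
move=> P1 PS x; apply: (@generated_left_ind K S) => [//|s y Ss Py|].
  by rewrite SV //; split; apply: PS.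
by rewrite genS.
Qed.

(** Prepending a generator to [y] multiplies [y ^+ 2] by a commutator with this
    generator. *)
Lemma commute_squares r : (forall s k, S s -> commute r [~ s, k]) ->
  forall y, commute r (y ^+ 2).
Proof.
move=> rS; apply: involution_generators_ind => [|s y Ss ry].
  by rewrite expg1n; apply: commute1.
have -> : (s * y) ^+ 2 = [~ s, y^-1] * y ^+ 2.
  by rewrite !expgS expg0 !mulg1 commgEl /conjg invgK (SV Ss) !mulgA mulgVK.
by apply: commuteM => //; apply: rS.
Qed.

Hypothesis exp4 : forall x : K, x ^+ 4 = 1.

(** For a generator [s], the element [r = [~ [~ s, u] ^ g, u]] commutes with all
    commutators [[~ s', k]] by [sandwich_commute], hence with all squares; this
    makes [r] right 2-Engel, since [[~ r, x ^+ 2] = [~ r, x] * [~ r, x] ^ x] in an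
    elementary abelian group. *)
Theorem left_2Engel_mod_R2 (u : K) : right_2Engel (u ^+ 2) ->
  forall x : K, right_2Engel [~ x, u, u].
Proof.
move=> u2; have [[R1 RF] RJ] := right_2Engel_normal K.
suff P (x : K) : forall g : K, right_2Engel [~ [~ x, u] ^ g, u].
  by move=> x; have := P x 1; rewrite conjg1.
move: x; apply: involution_generators_ind => [g|s y Ss yP g].
  by rewrite comm1g conj1g comm1g; apply: R1.
rewrite commgMl conjMg -conjgM commgMl.
apply: right_2EngelM => //; apply: right_2EngelJ; move: (y * g) => {}g.
pose N := normal_closure [set s]; have [gN NJ] := normal_closure_normal [set s].
have abN s' : S s' -> abelian_set (normal_closure [set s']).
  by move=> /SE /left_2Engel_closure_abelian.
have nN : is_normal_subgroup N by [].
have NR (B : set K) x k : is_normal_subgroup B -> B x -> B [~ x, k].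
  move=> [gB BJ] Bx; rewrite commgEl; apply: is_subgroupM => //; last exact: BJ.
  exact: is_subgroupV.
have Ns : N s by move=> B [_]; apply.
set r := [~ _, u]; have Nr : N r by apply: (NR N _ _ nN); apply: NJ; apply: (NR N _ _ nN).
have N2 := normal_closure_exponent2 (S2 Ss) (abN s Ss).
have rsq : forall y, commute r (y ^+ 2).
  apply: commute_squares => s' k Ss'.
  have [gN' NJ'] := normal_closure_normal [set s'].
  have Nw : normal_closure [set s'] [~ s', k] by apply: (NR _ s') => [|B [_]]; [split | apply].
  apply: (@sandwich_commute K (Subgroup gN) NJ (abN s Ss) N2 exp4) => //.
  - move=> x; apply/eqP/commgP/(abN s' Ss') => //; rewrite commgEr.
    by apply: (is_subgroupM gN') => //; apply: NJ'; apply: (is_subgroupV gN').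
  - move=> q qP q2; have -> : [~ s', k] = (s' * k^-1) ^+ 2 * k ^+ 2.
      rewrite !expgS !expg0 !mulg1 commgEl /conjg (SV Ss') !mulgA.
      by rewrite mulgVK.
    by apply: commuteM; apply: right_2Engel_commute_square.
move=> x; have Nrx : N [~ r, x] by apply: (NR N).
have rxV : [~ r, x]^-1 = [~ r, x].
  by apply: (mulgI [~ r, x]); rewrite mulgV -(N2 _ Nrx) expgS expg1.
apply/eqP/conjg_fixP; have /commgP/eqP := rsq x.
rewrite expgS expg1 commgMr.
by move/(canRL (mulKg _)); rewrite mulg1 rxV.
Qed.

End InvolutionGenerators.

Section QuotientEngel.
Local Open Scope classical_set_scope.
Local Open Scope group_scope.

Lemma quotient_left_2Engel (K : groupType) (S : set K) :
  generated S = setT -> (forall s, S s -> s ^+ 2 = 1) ->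
  (forall s, S s -> left_2Engel s) -> (forall x : K, x ^+ 4 = 1) ->
  forall u : quotient (R2 K), involution u -> left_2Engel u.
Proof.
move=> gS S2 SE e4 u; have [{}u <-] := coset_surj u.
case=> _; rewrite expgS expg1 -cosetM => /coset_eq1 uP x.
have [{}x <-] := coset_surj x.
rewrite -!(morphismR (@cosetM _ _)); apply/coset_eq1.
exact: (left_2Engel_mod_R2 gS S2 SE e4 uP x).
Qed.

End QuotientEngel.

(** * Nested commutators *)

(** The second components [Y] lie in successive derived subgroups; the first
    components [U] only serve the recursion.  The letters used at level [k]
    from [s] on are [s, ..., s + 2 ^ k.+1 - 1]. *)
Fixpoint nested_comm (G : groupType) (e : nat -> G) k s : G * G :=
  if k is k'.+1 then
    let: (u, y) := nested_comm e k' s in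
    let: (_, y') := nested_comm e k' (s + 2 ^ k) in
    ([~ y, y']%g, [~ u, y']%g)
  else ([~ e s, e s.+1]%g, e s).

(** The monomials (as lists of edges) through which [nested_comm] acts, and the
    letter whose step is scaled by the second one. *)
Fixpoint nested_data k s : seq (nat * nat) * seq (nat * nat) * nat :=
  if k is k'.+1 then
    let: (u, y, j) := nested_data k' s in
    let: (_, y', j') := nested_data k' (s + 2 ^ k) in
    ((j, j') :: y ++ y', u ++ y', j')
  else ([:: (s, s.+1)], [::], s).

Definition verts (es : seq (nat * nat)) := flatten [seq [:: e.1; e.2] | e <- es].

Lemma verts_cat es es' : verts (es ++ es') = verts es ++ verts es'.
Proof. by rewrite /verts map_cat flatten_cat. Qed.

Lemma nested_data_bounds k s : let: (u, y, j) := nested_data k s in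
  all (fun i => s <= i < s + 2 ^ k.+1) (verts u) &&
  all (fun i => s <= i < s + 2 ^ k.+1) (j :: verts y).
Proof.
elim: k s => [|k IH] s; first by rewrite /= !andbT; lia.
rewrite [nested_data _ _]/=; have := IH s; have := IH (s + 2 ^ k.+1).
case: nested_data => [[u' y'] j']; case: nested_data => [[u y] j].
rewrite /= !(verts_cat, all_cat) -!/(verts _).
have w l : all (fun i => s <= i < s + 2 ^ k.+1) l ->
    all (fun i => s <= i < s + 2 ^ k.+2) l.
  by apply: sub_all => i; rewrite (expnS _ k.+1); lia.
have w' l : all (fun i => s + 2 ^ k.+1 <= i < s + 2 ^ k.+1 + 2 ^ k.+1) l ->
    all (fun i => s <= i < s + 2 ^ k.+2) l.
  by apply: sub_all => i; rewrite (expnS _ k.+1); lia.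
case/andP=> _ /andP[bj' /w' by'] /andP[/w bu /andP[bj /w by_]].
rewrite -!/(verts _) verts_cat all_cat bu by_ by' !andbT.
by move: bj bj'; rewrite !(expnS _ k.+1); lia.
Qed.

Lemma nested_data_uniq k s : let: (u, y, j) := nested_data k s in
  uniq (verts u) && uniq (j :: verts y).
Proof.
elim: k s => [|k IH] s; first by rewrite /= inE andbT; lia.
rewrite [nested_data _ _]/=; have := IH s; have := IH (s + 2 ^ k.+1).
have := nested_data_bounds k s; have := nested_data_bounds k (s + 2 ^ k.+1).
case: nested_data => [[u' y'] j']; case: nested_data => [[u y] j].
case/andP=> _ B' /andP[Bu By] /andP[_ U'] /andP[Uu Uy].
have disj l l' : all (fun i => s <= i < s + 2 ^ k.+1) l ->
    all (fun i => s + 2 ^ k.+1 <= i < s + 2 ^ k.+1 + 2 ^ k.+1) l' ->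
    uniq l -> uniq l' -> uniq (l ++ l').
  move=> /allP lB /allP lB' ul ul'; rewrite cat_uniq ul ul' andbT.
  by apply/hasPn => i /lB' il'; apply/negP => /lB; move: il'; lia.
have yy' := disj _ _ By B' Uy U'; have uy' := disj _ _ Bu B' Uu U'.
rewrite [verts (u ++ _)]verts_cat; apply/andP; split.
  move: yy'; congr is_true; apply: perm_uniq.
  rewrite -[X in perm_eq X _]/((j :: verts y) ++ [:: j'] ++ verts y').
  rewrite -[X in perm_eq _ X]/([:: j; j'] ++ verts (y ++ y')) verts_cat.
  by rewrite perm_cons perm_catCA.
move: uy'; congr is_true; apply: perm_uniq.
by rewrite -[j' :: verts y']cat1s perm_catCA.
Qed.

(** * An action of the freest group *)

Section Model.
Local Open Scope ring_scope.
Variables (R : comPzRingType) (om : nat -> nat -> R).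
Hypothesis char2 : forall x : R, x + x = 0.
Hypothesis om_sym : forall i j, om i j = om j i.
Hypothesis om_alt : forall i, om i i = 0.
Hypothesis om_nil : forall i j k, om i j * om i k = 0.
Hypothesis om_plucker : forall i j k l,
  om i j * om k l + om i k * om j l + om i l * om j k = 0.
Hypothesis om_cyclic : forall p q r x y z,
  om p x * om q y * om r z + om p y * om q z * om r x
    + om p z * om q x * om r y = 0.

(** Used to subtract [q] times a known relation [l = r] from a goal. *)
Lemma lincomb (q l r x y : R) : l = r -> x = y + q * (l + r) -> x = y.
Proof. by move=> <- ->; rewrite char2 mulr0 addr0. Qed.

(** The linear relations that hold between the entries of each row [om i].  The
    coefficient vectors of all words satisfy them as well. *)
Record om_vector (F : nat -> R) : Prop := OmVector {
  vec_nil : forall i j, F i * om i j = 0;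
  vec_plucker : forall i j k, F i * om j k + F j * om i k + F k * om i j = 0;
  vec_cyclic : forall p q x y z, F x * om p y * om q z + F y * om p z * om q x
    + F z * om p x * om q y = 0 }.

Lemma om_vector_row i : om_vector (om i).
Proof.
split=> [j k|j k l|p q x y z]; last exact: om_cyclic.
  by rewrite om_sym om_nil.
rewrite -[RHS](om_plucker i j k l); char2_ring char2.
Qed.

Lemma om_vectorDZ (r : R) F G : om_vector F -> om_vector G ->
  om_vector (fun y => F y + r * G y).
Proof.
move=> FV GV; split=> [i j|i j k|p q x y z].
- apply: (lincomb (q := 1) (vec_nil FV i j)).
  by apply: (lincomb (q := r) (vec_nil GV i j)); char2_ring char2.
- apply: (lincomb (q := 1) (vec_plucker FV i j k)).
  by apply: (lincomb (q := r) (vec_plucker GV i j k)); char2_ring char2.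
- apply: (lincomb (q := 1) (vec_cyclic FV p q x y z)).
  by apply: (lincomb (q := r) (vec_cyclic GV p q x y z)); char2_ring char2.
Qed.

Lemma om_vector_ext F G : F =1 G -> om_vector F -> om_vector G.
Proof. by move=> /funext ->. Qed.

Lemma om_vector0 : om_vector (fun _ => 0).
Proof. by split=> *; rewrite !mul0r ?addr0. Qed.

(** A word [g] maps [(1, 0)] to [(1 + a, c)] and [(0, om y)] to
    [(b y, om y + d ^~ y)].  The scalar [t] enters through the products of these
    coefficients, as in [inv_bc] and [inv_dd]. *)
Record coefs := Coefs { coefa : R; coefb : nat -> R; coefc : nat -> R;
  coefd : nat -> nat -> R; coeft : R }.

Definition coefv g y := coefb g y + coefc g y.

Definition coefs_cons i (g : coefs) : coefs :=
  Coefs (coefa g + coefc g i)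
    (fun y => coefb g y + om i y + coefd g i y)
    (fun y => coefc g y + om i y + coefa g * om i y)
    (fun x y => coefd g x y + coefb g y * om i x)
    (coeft g + coefv g i).

Definition coefs_one := Coefs 0 (fun _ => 0) (fun _ => 0) (fun _ _ => 0) 0.

(** Relations that survive the addition of a letter and imply [(g - 1) ^ 3 = 0]. *)
Record coefs_inv (g : coefs) : Prop := CoefsInv {
  inv_aa : coefa g * coefa g = 0;
  inv_ab : forall y, coefa g * coefb g y = 0;
  inv_ac : forall y, coefa g * coefc g y = 0;
  inv_cc : forall y z, coefc g y * coefc g z = coefa g * om y z;
  inv_bb : forall y z, coefb g y * coefb g z = coefa g * om y z;
  inv_bc : forall y z, coefb g y * coefc g z = (coefa g + coeft g) * om y z;
  inv_ad : forall x y, coefa g * coefd g x y = coeft g * om x y;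
  inv_bd : forall x y z, coefb g x * coefd g y z = coefv g x * om y z;
  inv_cd : forall x y z, coefc g x * coefd g y z = coefv g x * om y z;
  inv_dd : forall x y z w,
    coefd g x y * coefd g z w = coeft g * om y z * om x w;
  inv_dC : forall y z,
    coefd g y z + coefd g z y = (coefa g + coeft g) * om y z;
  inv_d0 : forall i, coefd g i i = 0;
  inv_ta : coeft g * coefa g = 0;
  inv_tb : forall y, coeft g * coefb g y = 0;
  inv_tc : forall y, coeft g * coefc g y = 0;
  inv_td : forall x y, coeft g * coefd g x y = 0;
  inv_tt : coeft g * coeft g = 0;
  inv_cyclic : forall i x y z, om x i * coefd g y z + om x y * coefd g z i
    + om x z * coefd g i y = 0;
  inv_vb : om_vector (coefb g);
  inv_vc : om_vector (coefc g);
  inv_vd : forall y, om_vector (coefd g ^~ y) }.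

Lemma coefs_inv_one : coefs_inv coefs_one.
Proof.
split=> *; rewrite /coefv /= ?(mulr0, mul0r, addr0) //; exact: om_vector0.
Qed.

Lemma inv_vdr g x : coefs_inv g -> om_vector (coefd g x).
Proof.
move=> gP; have := om_vectorDZ (coefa g + coeft g) (inv_vd gP x)
  (om_vector_row x).
apply: om_vector_ext => y /=; rewrite -(inv_dC gP).
by char2_ring char2.
Qed.

(** [inv_bd] and [inv_cd] are preserved because of this exchange. *)
Lemma inv_exchange g i x y z : coefs_inv g ->
  om i x * coefd g y z + coefd g i x * om y z
    = (coefa g + coeft g) * om x y * om i z.
Proof.
move=> gP; apply: (lincomb (q := 1) (inv_cyclic gP i x y z)).
apply: (lincomb (q := om x y) (inv_dC gP i z)).
apply: (lincomb (q := 1) (vec_plucker (inv_vdr i gP) x y z)).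
rewrite (om_sym i x); char2_ring char2.
Qed.

Section Cons.
Variables (i : nat) (g : coefs).
Hypothesis gP : coefs_inv g.
Let g' := coefs_cons i g.

Local Notation a := (coefa g).
Local Notation b := (coefb g).
Local Notation c := (coefc g).
Local Notation d := (coefd g).
Local Notation t := (coeft g).
Local Notation v := (coefv g).

Let bo y : b i * om i y = 0. Proof. exact: vec_nil (inv_vb gP) i y. Qed.
Let co y : c i * om i y = 0. Proof. exact: vec_nil (inv_vc gP) i y. Qed.
Let dlo y z : d i z * om i y = 0. Proof. exact: vec_nil (inv_vd gP z) i y. Qed.
Let oo y z : om i y * om i z = 0. Proof. exact: om_nil. Qed.
Let bP y z : b y * om i z = b z * om i y + b i * om y z.
Proof.
apply: (lincomb (q := 1) (vec_plucker (inv_vb gP) i y z)); char2_ring char2.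
Qed.
Let cP y z : c y * om i z = c z * om i y + c i * om y z.
Proof.
apply: (lincomb (q := 1) (vec_plucker (inv_vc gP) i y z)); char2_ring char2.
Qed.
Let ii0 : om i i = 0. Proof. exact: om_alt. Qed.
Let vvec : om_vector v.
Proof.
apply: om_vector_ext (om_vectorDZ 1 (inv_vb gP) (inv_vc gP)) => y.
by rewrite mul1r.
Qed.
Let vP y z : v y * om i z = v z * om i y + v i * om y z.
Proof.
apply: (lincomb (q := 1) (vec_plucker vvec i y z)); char2_ring char2.
Qed.

Tactic Notation "lc" constr(q) constr(e) := apply: (lincomb (q := q) e).

(* In each proof below, [lc] lists the relations between the old coefficients that
   the expansion of the new ones calls for, with their multipliers. *)
Let aa' : coefa g' * coefa g' = 0.
Proof.
by rewrite /=; lc (1 : R) (inv_aa gP); lc (1 : R) (inv_cc gP i i); lc a ii0;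
  char2_ring char2.
Qed.

Let ac' y : coefa g' * coefc g' y = 0.
Proof.
rewrite /=; lc (1 : R) (inv_ac gP y); lc (om i y) (inv_aa gP).
by lc (1 : R) (inv_cc gP i y); lc (1 + a) (co y); char2_ring char2.
Qed.

Let ab' y : coefa g' * coefb g' y = 0.
Proof.
rewrite /=; lc (1 : R) (inv_ab gP y); lc (1 : R) (inv_ad gP i y).
lc (1 : R) (inv_bc gP y i); lc (1 : R) (co y); lc (1 : R) (inv_cd gP i i y).
rewrite (om_sym y i); lc (1 : R) (vec_nil vvec i y); char2_ring char2.
Qed.

Let cc' y z : coefc g' y * coefc g' z = coefa g' * om y z.
Proof.
rewrite /=; lc (1 : R) (inv_cc gP y z); lc (om i z) (inv_ac gP y).
lc (om i y) (inv_ac gP z); lc (1 : R) (cP y z).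
by lc (1 + a) (oo y z); lc (a + a * a) (oo y z); char2_ring char2.
Qed.

Let bb' y z : coefb g' y * coefb g' z = coefa g' * om y z.
Proof.
rewrite /=; lc (1 : R) (inv_bb gP y z); lc (1 : R) (bP y z).
lc (1 : R) (inv_bd gP y i z); lc (1 : R) (inv_bd gP z i y); lc (1 : R) (oo y z).
lc (1 : R) (dlo y z); lc (1 : R) (dlo z y); lc (1 : R) (inv_dd gP i y i z).
rewrite (om_sym y i); lc (t) (oo y z); lc (1 : R) (vP y z).
by rewrite /coefv; char2_ring char2.
Qed.

Let bc' y z : coefb g' y * coefc g' z = (coefa g' + coeft g') * om y z.
Proof.
rewrite /=; lc (1 : R) (inv_bc gP y z); lc (om i z) (inv_ab gP y).
lc (1 + a) (oo y z); lc (1 : R) (inv_cd gP z i y); lc (1 + a) (dlo z y).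
lc (1 : R) (bP y z).
by rewrite /coefv; char2_ring char2.
Qed.

Let ad' x y : coefa g' * coefd g' x y = coeft g' * om x y.
Proof.
rewrite /=; lc (1 : R) (inv_ad gP x y); lc (om i x) (inv_ab gP y).
lc (1 : R) (inv_cd gP i x y); lc (b y) (co x); char2_ring char2.
Qed.

Let bd' x y z : coefb g' x * coefd g' y z = coefv g' x * om y z.
Proof.
rewrite /coefv /=; lc (1 : R) (inv_bd gP x y z); lc (om i y) (inv_bb gP x z).
lc (b z) (oo x y); lc (1 : R) (inv_dd gP i x y z); lc (b z) (dlo y x).
lc (1 : R) (inv_exchange i x y z gP); lc a (om_plucker i x y z).
by rewrite /coefv; char2_ring char2.
Qed.

Let cd' x y z : coefc g' x * coefd g' y z = coefv g' x * om y z.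
Proof.
rewrite /coefv /=; lc (1 : R) (inv_cd gP x y z); lc (om i y) (inv_bc gP z x).
lc (b z + a * b z) (oo x y); lc (om i x) (inv_ad gP y z).
lc (1 : R) (inv_exchange i x y z gP); lc (a + t) (om_plucker i x y z).
by rewrite /coefv (om_sym z x); char2_ring char2.
Qed.

Let dd' x y z w :
  coefd g' x y * coefd g' z w = coeft g' * om y z * om x w.
Proof.
rewrite /=; lc (1 : R) (inv_dd gP x y z w); lc (om i z) (inv_bd gP w x y).
lc (om i x) (inv_bd gP y z w); lc (b y * b w) (oo x z).
lc (1 : R) (vec_cyclic vvec z x i y w).
rewrite (om_sym z y) (om_sym z i) (om_sym x i); char2_ring char2.
Qed.

Let dC' y z :
  coefd g' y z + coefd g' z y = (coefa g' + coeft g') * om y z.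
Proof.
rewrite /=; lc (1 : R) (inv_dC gP y z); lc (1 : R) (bP y z).
by rewrite /coefv; char2_ring char2.
Qed.

Let d0' k : coefd g' k k = 0.
Proof.
rewrite /=; lc (1 : R) (inv_d0 gP k); lc (1 : R) (vec_nil (inv_vb gP) k i).
rewrite (om_sym k i); char2_ring char2.
Qed.

Let ta' : coeft g' * coefa g' = 0.
Proof.
rewrite /= /coefv; lc (1 : R) (inv_ta gP); lc (1 : R) (inv_ab gP i).
lc (1 : R) (inv_ac gP i); lc (1 : R) (inv_tc gP i); lc (1 : R) (inv_bc gP i i).
lc (1 : R) (inv_cc gP i i); lc t ii0; char2_ring char2.
Qed.

Let tb' y : coeft g' * coefb g' y = 0.
Proof.
rewrite /= /coefv; lc (1 : R) (inv_tb gP y); lc (1 : R) (inv_td gP i y).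
lc (1 : R) (inv_bb gP i y); lc (1 : R) (inv_bc gP y i).
lc (1 : R) (bo y); lc (1 : R) (co y); lc (1 : R) (inv_bd gP i i y).
lc (1 : R) (inv_cd gP i i y); rewrite (om_sym y i); char2_ring char2.
Qed.

Let tc' y : coeft g' * coefc g' y = 0.
Proof.
rewrite /= /coefv; lc (1 : R) (inv_tc gP y); lc (om i y) (inv_ta gP).
lc (1 : R) (inv_bc gP i y); lc (1 : R) (inv_cc gP i y).
lc (1 + a) (bo y); lc (1 + a) (co y); char2_ring char2.
Qed.

Let td' x y : coeft g' * coefd g' x y = 0.
Proof.
rewrite /= /coefv; lc (1 : R) (inv_td gP x y); lc (om i x) (inv_tb gP y).
lc (1 : R) (inv_bd gP i x y); lc (1 : R) (inv_cd gP i x y).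
lc (b y) (bo x); lc (b y) (co x); char2_ring char2.
Qed.

Let tt' : coeft g' * coeft g' = 0.
Proof.
rewrite /= /coefv; lc (1 : R) (inv_tt gP); lc (1 : R) (inv_bb gP i i).
lc (1 : R) (inv_cc gP i i); char2_ring char2.
Qed.

Let cyclic' k x y z : om x k * coefd g' y z + om x y * coefd g' z k
  + om x z * coefd g' k y = 0.
Proof.
rewrite /=; lc (1 : R) (inv_cyclic gP k x y z).
lc (1 : R) (vec_cyclic (inv_vb gP) x i z k y).
by char2_ring char2.
Qed.

Let vb' : om_vector (coefb g').
Proof.
apply: om_vector_ext (om_vectorDZ 1 (inv_vb gP)
  (om_vectorDZ 1 (om_vector_row i) (inv_vdr i gP))) => y /=.
char2_ring char2.
Qed.

Let vc' : om_vector (coefc g').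
Proof.
apply: om_vector_ext (om_vectorDZ (1 + a) (inv_vc gP) (om_vector_row i)) => y /=.
char2_ring char2.
Qed.

Let vd' y : om_vector (coefd g' ^~ y).
Proof. exact: om_vectorDZ (inv_vd gP y) (om_vector_row i). Qed.

Lemma coefs_inv_cons : coefs_inv g'.
Proof. by split. Qed.

End Cons.

Definition word_coefs (s : seq nat) : coefs := foldr coefs_cons coefs_one s.

Lemma word_coefs_inv s : coefs_inv (word_coefs s).
Proof.
by elim: s => [|i s IH]; [exact: coefs_inv_one | exact: coefs_inv_cons].
Qed.

Definition vect : Type := (R * (nat -> R))%type.
Implicit Types (p q : vect) (r m : R) (F : nat -> R).

Lemma vect_ext p q : p.1 = q.1 -> p.2 =1 q.2 -> p = q.
Proof. by case: p q => m F [m' F'] /= -> /funext ->. Qed.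

Definition comb r p q : vect := (p.1 + r * q.1, fun y => p.2 y + r * q.2 y).

Definition step i p : vect := (p.1 + p.2 i, fun y => p.2 y + p.1 * om i y).

Definition action (s : seq nat) p := foldr step p s.

Lemma action_comb s r p q :
  action s (comb r p q) = comb r (action s p) (action s q).
Proof.
elim: s => //= i s ->; set p' := action s p; set q' := action s q.
by apply: vect_ext => [|y] /=; char2_ring char2.
Qed.

Definition vect_one : vect := (1, fun _ => 0).
Definition vect_row y : vect := (0, om y).

Section WordAction.
Variable s : seq nat.
Let gP := word_coefs_inv s.
Local Notation a := (coefa (word_coefs s)).
Local Notation b := (coefb (word_coefs s)).
Local Notation c := (coefc (word_coefs s)).
Local Notation d := (coefd (word_coefs s)).
Local Notation t := (coeft (word_coefs s)).
Local Notation v := (coefv (word_coefs s)).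

Lemma action_one : action s vect_one = (1 + a, c).
Proof.
elim: s => [|i s' /= ->]; first by apply: vect_ext => [|y] /=; rewrite ?addr0.
by apply: vect_ext => [|y] /=; char2_ring char2.
Qed.

Lemma action_row y : action s (vect_row y) = (b y, fun x => om y x + d x y).
Proof.
elim: s => [|i s' /= ->]; first by apply: vect_ext => [|x] /=; rewrite ?addr0.
by apply: vect_ext => [|x] /=; rewrite ?(om_sym y i); char2_ring char2.
Qed.

End WordAction.

(** Each word [g] acts in a simple way on its own coefficients: it exchanges [b]
    and [c], and moves the columns of [d] only in the scalar component. *)
Lemma action_c s : action s (0, coefc (word_coefs s)) = (0, coefb (word_coefs s)).
Proof.
elim: s => [//|i s IH] /=; have gP := word_coefs_inv s.
have -> : (0, coefc (coefs_cons i (word_coefs s))) =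
    comb (1 + coefa (word_coefs s)) (0, coefc (word_coefs s)) (vect_row i).
  by apply: vect_ext => [|y] /=; char2_ring char2.
rewrite action_comb IH action_row; move: (word_coefs s) gP => g gP.
have ii0 := om_alt i.
apply: vect_ext => [|y] /=.
  apply: (lincomb (q := 1) (inv_ab gP i)).
  apply: (lincomb (q := 1 + coefa g) ii0).
  apply: (lincomb (q := 1 + coefa g) (inv_d0 gP i)).
  by char2_ring char2.
apply: (lincomb (q := 1) (inv_ad gP y i)).
apply: (lincomb (q := om i y) (inv_ab gP i)).
apply: (lincomb (q := 1) (vec_nil (inv_vb gP) i y)).
apply: (lincomb (q := 1) (inv_dC gP i y)).
by rewrite (om_sym y i); char2_ring char2.
Qed.

Lemma action_d s y :
  action s (0, fun x => coefd (word_coefs s) x y)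
    = (coefv (word_coefs s) y, fun x => coefd (word_coefs s) x y).
Proof.
elim: s => [|i s IH] /=.
  by apply: vect_ext => [|x] /=; rewrite /coefv ?addr0.
have gP := word_coefs_inv s.
have -> : (0, fun x => coefd (coefs_cons i (word_coefs s)) x y) =
    comb (coefb (word_coefs s) y) (0, fun x => coefd (word_coefs s) x y)
      (vect_row i).
  by apply: vect_ext => [|x] /=; char2_ring char2.
rewrite action_comb IH action_row; move: (word_coefs s) gP => g gP.
apply: vect_ext => [|x] /=.
  apply: (lincomb (q := coefb g y) (om_alt i)).
  apply: (lincomb (q := coefb g y) (inv_d0 gP i)).
  apply: (lincomb (q := 1) (inv_bb gP y i)).
  by rewrite (om_sym y i) /coefv /=; char2_ring char2.
apply: (lincomb (q := 1) (inv_bd gP y x i)).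
apply: (lincomb (q := om i x) (inv_bb gP y i)).
apply: (lincomb (q := coefa g) (om_nil i x y)).
by rewrite (om_sym y i) (om_sym x i) /coefv; char2_ring char2.
Qed.

Lemma action_b s : action s (0, coefb (word_coefs s)) = (0, coefc (word_coefs s)).
Proof.
elim: s => [//|i s IH] /=; have gP := word_coefs_inv s.
have -> : (0, coefb (coefs_cons i (word_coefs s))) =
    comb (1 + (coefa (word_coefs s) + coeft (word_coefs s)))
      (comb 1 (0, coefb (word_coefs s))
         (0, fun x => coefd (word_coefs s) x i)) (vect_row i).
  apply: vect_ext => [|y] /=; first by char2_ring char2.
  by apply: (lincomb (q := 1) (inv_dC gP i y)); char2_ring char2.
rewrite !action_comb IH action_row action_d.
move: (word_coefs s) gP => g gP.
apply: vect_ext => [|y] /=.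
  apply: (lincomb (q := 1) (inv_ab gP i)); apply: (lincomb (q := 1) (inv_tb gP i)).
  apply: (lincomb (q := 1 + (coefa g + coeft g)) (om_alt i)).
  apply: (lincomb (q := coefa g + coeft g) (inv_d0 gP i)).
  by rewrite /coefv; char2_ring char2.
apply: (lincomb (q := 1) (inv_ad gP y i)); apply: (lincomb (q := 1) (inv_td gP y i)).
apply: (lincomb (q := 1) (vec_nil (inv_vc gP) i y)).
apply: (lincomb (q := om i y) (inv_ab gP i)).
apply: (lincomb (q := om i y) (inv_tb gP i)).
by rewrite (om_sym y i) /coefv; char2_ring char2.
Qed.

(** The relators are tested on these vectors only: the fourth powers are computed
    from the images of [(1, 0)] and [(0, om j)]. *)
Inductive rowspan : (nat -> R) -> Prop :=
| rowspan0 : rowspan (fun _ => 0)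
| rowspanD r j F : rowspan F -> rowspan (fun y => F y + r * om j y).

Lemma rowspan_vector F : rowspan F -> om_vector F.
Proof.
elim=> [|r j {}F _ FV]; first exact: om_vector0.
by apply: om_vectorDZ => //; apply: om_vector_row.
Qed.

Lemma rowspanZ r F : rowspan F -> rowspan (fun y => r * F y).
Proof.
elim=> [|q j {}F _ IH].
  have -> : (fun _ : nat => r * 0) = (fun _ => 0) by apply/funext=> y; rewrite mulr0.
  exact: rowspan0.
have -> : (fun y => r * (F y + q * om j y)) = (fun y => r * F y + (r * q) * om j y).
  by apply/funext=> y; rewrite mulrDr mulrA.
exact: rowspanD.
Qed.

Lemma action_rowspan s p : rowspan p.2 -> rowspan (action s p).2.
Proof. by elim: s => //= i s IH /IH; apply: rowspanD. Qed.

Lemma stepK i p : om_vector p.2 -> step i (step i p) = p.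
Proof.
move=> FV; apply: vect_ext => [|y] /=.
  by apply: (lincomb (q := p.1) (om_alt i)); char2_ring char2.
by apply: (lincomb (q := 1) (vec_nil FV i y)); char2_ring char2.
Qed.

(** As [g] exchanges [b] and [c], the square [g ^ 2] adds [b + c] to [(1, 0)] and
    fixes this increment; and it maps [(0, om y)] to a combination of [(1, 0)] and
    [(0, om y)]. *)
Lemma action_pow4 s p : rowspan p.2 -> action s (action s (action s (action s p))) = p.
Proof.
have gP := word_coefs_inv s; have e1 := action_one s; have eb := action_b s.
have ec := action_c s; have ed := action_d s; have er := action_row s.
have sq1 : action s (action s vect_one) = comb 1 (comb 1 vect_one
    (0, coefb (word_coefs s))) (0, coefc (word_coefs s)).
  set g := word_coefs s in gP e1 eb ec ed er *.
  rewrite e1; have -> : (1 + coefa g, coefc g) =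
      comb 1 (comb (coefa g) vect_one vect_one) (0, coefc g).
    by apply: vect_ext => [|y] /=; char2_ring char2.
  rewrite !action_comb e1 ec; apply: vect_ext => [|y] /=.
    by apply: (lincomb (q := 1) (inv_aa gP)); char2_ring char2.
  by apply: (lincomb (q := 1) (inv_ac gP y)); char2_ring char2.
have one : action s (action s (action s (action s vect_one))) = vect_one.
  rewrite sq1 !action_comb sq1 !(eb, ec).
  by apply: vect_ext => [|y] /=; char2_ring char2.
have row y : action s (action s (action s (action s (vect_row y)))) = vect_row y.
  set g := word_coefs s in gP sq1 e1 eb ec ed er.
  have sq : action s (action s (vect_row y)) =
      comb (coefa g + coeft g) (comb (coefv g y) (vect_row y) vect_one) (vect_row y).
    rewrite er; have -> : (coefb g y, fun x => om y x + coefd g x y) =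
        comb (coefb g y) (comb 1 (vect_row y) (0, coefd g ^~ y)) vect_one.
      by apply: vect_ext => [|x] /=; char2_ring char2.
    rewrite !action_comb er e1 ed; apply: vect_ext => [|x] /=.
      by apply: (lincomb (q := 1) (inv_ab gP y)); char2_ring char2.
    by apply: (lincomb (q := 1) (inv_bc gP y x)); char2_ring char2.
  rewrite sq !action_comb sq sq1; apply: vect_ext => [|x] /=.
    apply: (lincomb (q := 1) (inv_ab gP y)); apply: (lincomb (q := 1) (inv_ac gP y)).
    apply: (lincomb (q := 1) (inv_tb gP y)); apply: (lincomb (q := 1) (inv_tc gP y)).
    by rewrite /coefv; char2_ring char2.
  apply: (lincomb (q := om y x) (inv_aa gP)); apply: (lincomb (q := om y x) (inv_tt gP)).
  apply: (lincomb (q := 1) (inv_bb gP y x)); apply: (lincomb (q := 1) (inv_cc gP y x)).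
  apply: (lincomb (q := 1) (inv_bc gP y x)); apply: (lincomb (q := 1) (inv_bc gP x y)).
  by rewrite (om_sym x y) /coefv; char2_ring char2.
have comb4 r q q' : action s (action s (action s (action s (comb r q q')))) =
    comb r (action s (action s (action s (action s q))))
      (action s (action s (action s (action s q')))) by rewrite !action_comb.
case: p => m F /= FV.
have -> : (m, F) = comb m (0, F) vect_one.
  by apply: vect_ext => [|y] /=; char2_ring char2.
rewrite comb4 one; congr comb; elim: {F} FV => [|r j F _ IH].
  have -> : (0, fun _ => 0) = comb 1 vect_one vect_one.
    by apply: vect_ext => [|y] /=; char2_ring char2.
  by rewrite comb4 one.
have -> : (0, fun y => F y + r * om j y) = comb r (0, F) (vect_row j).
  by apply: vect_ext => [|y] /=; char2_ring char2.
by rewrite comb4 row IH.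
Qed.

Local Notation fgroup := (free_group nat).
Implicit Types (u w : fgroup).

(** As the steps are involutions on the vectors of interest, a letter and its
    inverse both act as the step. *)
Definition act w p := action (map fst (val w)) p.

Lemma actM u w p : rowspan p.2 -> act (u * w)%g p = act u (act w p).
Proof.
move=> pS; case: u => u ru; rewrite /act /=; elim: u {ru} => //= a u <-.
case: (foldr _ _ _) => //= b v; case: eqP => //= ->.
by rewrite stepK //; apply: rowspan_vector; apply: action_rowspan.
Qed.

Lemma act_rowspan w p : rowspan p.2 -> rowspan (act w p).2.
Proof. exact: action_rowspan. Qed.

Lemma actK w p : rowspan p.2 -> act w^-1%g (act w p) = p.
Proof. by move=> pS; rewrite -actM // mulVg. Qed.

Definition act_as w (f : vect -> vect) := forall p, rowspan p.2 -> act w p = f p.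

Lemma act_kernel_normal : is_normal_subgroup [set w | act_as w id].
Proof.
split; [split=> [p //|u w /= uP wP p pS]|move=> w u /= wP p pS].
  rewrite actM // uP; last exact: act_rowspan.
  by rewrite -{1}(wP p pS) actK.
have pS' : rowspan (act u p).2 by exact: act_rowspan.
rewrite /conjg !actM //.
by rewrite (wP (act u p)) ?actK.
Qed.

Definition act_kernel := NormalSubgroup act_kernel_normal.

(** A condition that holds on the image of [x_i - 1], is preserved by all words,
    and implies that [x_i - 1] vanishes; so [(x_i - 1) g (x_i - 1) = 0]. *)
Definition step_killed i p : Prop :=
  [/\ forall j, p.1 * om i j = 0, p.2 i = 0 & forall k j, p.2 k * om i j = 0].

Lemma action_killed i s p : step_killed i p -> step_killed i (action s p).
Proof.
elim: s => //= k s IH /IH [m0 F0 Fk]; split=> [j||l j] /=.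
- by rewrite mulrDl m0 Fk addr0.
- by rewrite F0 om_sym m0 addr0.
- by rewrite mulrDl Fk -mulrA (mulrC (om k l)) mulrA m0 mul0r addr0.
Qed.

Lemma step_killed_fix i p : step_killed i p -> step i p = p.
Proof.
by case=> m0 F0 _; apply: vect_ext => [|y] /=; rewrite ?F0 ?m0 addr0.
Qed.

Lemma killed_step i p : om_vector p.2 ->
  step_killed i (p.2 i, fun y => p.1 * om i y).
Proof.
move=> FV; split=> [j||k j] /=; first exact: vec_nil.
  by rewrite om_alt mulr0.
by rewrite -mulrA om_nil mulr0.
Qed.

Lemma stepE i p : step i p = comb 1 p (p.2 i, fun y => p.1 * om i y).
Proof. by apply: vect_ext => [|y] /=; rewrite mul1r. Qed.

Lemma act_gen i p : act (free_gen i) p = step i p. Proof. by []. Qed.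

Lemma rowspan_row r j : rowspan (fun y => r * om j y).
Proof.
have := rowspanD r j rowspan0.
by rewrite (_ : (fun _ => _) = (fun y => r * om j y)) //; apply/funext => y; rewrite add0r.
Qed.

(** Writing [x_i = 1 + X], both sides are [1 + X + f^-1 X f], as [X g X = 0]. *)
Lemma commute_step_conj i f p : rowspan p.2 ->
  act (free_gen i * free_gen i ^ f)%g p = act (free_gen i ^ f * free_gen i)%g p.
Proof.
set x := free_gen i; pose E q : vect := (q.2 i, fun y => q.1 * om i y) => pS.
have fS u q : rowspan q.2 -> rowspan (act u q).2 by exact: act_rowspan.
have kil u q : rowspan q.2 -> step_killed i (act u (E q)).
  by move=> qS; apply/action_killed/killed_step/rowspan_vector.
have conjE q : rowspan q.2 -> act (x ^ f)%g q = act f^-1%g (act x (act f q)).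
  by move=> qS; rewrite /conjg !actM //; do ?exact: fS.
have pf : act (x ^ f)%g p = comb 1 p (act f^-1%g (E (act f p))).
  by rewrite conjE // act_gen stepE [LHS]action_comb -!/(act _ _) actK.
have Ef : act (x ^ f)%g (E p) = E p.
  have ES : rowspan (E p).2 by exact: rowspan_row.
  by rewrite conjE // act_gen step_killed_fix ?actK //; apply: kil.
have actC u r q q' : act u (comb r q q') = comb r (act u q) (act u q').
  exact: action_comb.
have xE q : act x q = comb 1 q (E q) by exact: stepE.
rewrite (actM x) // (actM (x ^ f)%g) // pf actC (xE p) [act (x ^ f)%g (comb _ _ _)]actC pf Ef.
have -> : act x (act f^-1%g (E (act f p))) = act f^-1%g (E (act f p)).
  by apply/step_killed_fix/kil/fS.
by apply: vect_ext => [|y] /=; char2_ring char2.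
Qed.

Lemma act_relator : (relators `<=` act_kernel)%classic.
Proof.
move=> w [[[i _ <-]|[f _ [i _ <-]]]|[f _ <-]].
- by move=> p pS; rewrite expgS expg1 actM // !act_gen stepK //; apply: rowspan_vector.
- apply/coset_eq1; set x := free_gen i.
  rewrite !(morphismR (@cosetM _ _)); apply/eqP/commgP; rewrite commgEr.
  have c : commute (coset act_kernel x) (coset act_kernel (x ^ f)).
    rewrite /commute -!cosetM; apply/coset_eqP => q qS.
    rewrite actM // -commute_step_conj // actK //.
  apply/commute_sym/commuteM => //; rewrite conjVg; apply: commuteV.
  by rewrite -(morphismJ (@cosetM _ _)).
- by move=> p pS; rewrite 3!expgS expg1 !actM //; exact: action_pow4.
Qed.

Definition shear f p : vect := (p.1, fun y => p.2 y + f * p.2 y).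
Definition scaled_step f j p : vect :=
  (p.1 + f * p.2 j, fun y => p.2 y + f * p.1 * om j y).

Lemma scaled_step_rowspan f j p : rowspan p.2 -> rowspan (scaled_step f j p).2.
Proof. exact: rowspanD. Qed.

Lemma shear_rowspan f p : rowspan p.2 -> rowspan (shear f p).2.
Proof.
move=> /(rowspanZ (1 + f)); rewrite (_ : (fun y => _) = (shear f p).2) //.
by apply/funext => y /=; rewrite mulrDl mul1r.
Qed.

(** The commutator is determined by [u * w = w * u * [~ u, w]]. *)
Lemma act_commg u w f f' k : act_as u f -> act_as w f' ->
  (forall p, rowspan p.2 -> rowspan (f p).2) ->
  (forall p, rowspan p.2 -> rowspan (f' p).2) ->
  (forall p, rowspan p.2 -> rowspan (k p).2) ->
  (forall p, rowspan p.2 -> f (f' p) = f' (f (k p))) -> act_as [~ u, w]%g k.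
Proof.
move=> uf wf fS wS kS e p pS.
have -> : [~ u, w]%g = ((w * u)^-1 * (u * w))%g by rewrite /commg /conjg invgM !mulgA.
rewrite actM // (actM u) // (wf p) // (uf (f' p)); last exact: wS.
rewrite e //; have kpS := kS p pS; have <- : act (w * u)%g (k p) = f' (f (k p)).
  by rewrite actM // (uf _ kpS) (wf _ (fS _ kpS)).
exact: actK.
Qed.

Lemma act_commg_steps u w f g i j : act_as u (scaled_step f i) ->
  act_as w (scaled_step g j) -> act_as [~ u, w]%g (shear (f * g * om i j)).
Proof.
move=> uf wg; apply: act_commg uf wg _ _ _ _ => p; try exact: scaled_step_rowspan.
  exact: shear_rowspan.
move=> /rowspan_vector pV; apply: vect_ext => [|y] /=.
  apply: (lincomb (q := f * f * g) (vec_nil pV i j)).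
  apply: (lincomb (q := f * g * g) (vec_nil pV j i)).
  by rewrite (om_sym j i); char2_ring char2.
apply: (lincomb (q := f * g) (vec_plucker pV i j y)).
apply: (lincomb (q := f * g * f * g * om j y) (vec_nil pV i j)).
by char2_ring char2.
Qed.

Lemma act_commg_shear u w f g j : f * f = 0 -> act_as u (shear f) ->
  act_as w (scaled_step g j) -> act_as [~ u, w]%g (scaled_step (f * g) j).
Proof.
move=> f2 uf wg; apply: act_commg uf wg _ _ _ _ => p; try exact: scaled_step_rowspan.
  exact: shear_rowspan.
move=> /rowspan_vector pV; apply: vect_ext => [|y] /=.
  apply: (lincomb (q := (f + f * f) * g * g * p.1) (om_alt j)).
  by char2_ring char2.
apply: (lincomb (q := f * g * g) (vec_nil pV j y)).
apply: (lincomb (q := g * p.1 * om j y) f2).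
by char2_ring char2.
Qed.

Definition monomial (es : seq (nat * nat)) : R := \prod_(e <- es) om e.1 e.2.

Lemma monomial_cat es es' : monomial (es ++ es') = monomial es * monomial es'.
Proof. exact: big_cat. Qed.

Lemma act_nested k s :
  let: (u, y) := nested_comm (@free_gen nat) k s in
  let: (es, es', j) := nested_data k s in
  [/\ monomial es * monomial es = 0, act_as u (shear (monomial es))
    & act_as y (scaled_step (monomial es') j)].
Proof.
have nil_sq e es : monomial (e :: es) * monomial (e :: es) = 0.
  rewrite /monomial big_cons mulrACA om_nil mul0r //.
have gen_step i : act_as (free_gen i) (scaled_step (monomial [::]) i).
  move=> p pS; rewrite act_gen; apply: vect_ext => [|y] /=;
  by rewrite /monomial big_nil !mul1r.
elim: k s => [|k IH] s.
  split=> //=.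
  have := act_commg_steps (gen_step s) (gen_step s.+1).
  by rewrite /monomial big_seq1 /= big_nil !mul1r.
rewrite [nested_comm _ _ _]/= [nested_data _ _]/=.
have := IH s; have := IH (s + 2 ^ k.+1)%N.
case: nested_comm => u' y'; case: nested_data => [[es1' es2'] j'].
case: nested_comm => u y; case: nested_data => [[es1 es2] j].
case=> _ _ y'P [es1P uP yP]; split.
- exact: nil_sq.
- have := act_commg_steps yP y'P.
  by rewrite -monomial_cat mulrC /monomial [in X in _ -> X]big_cons.
- by have := act_commg_shear es1P uP y'P; rewrite -monomial_cat.
Qed.

Hypothesis monomial_neq0 : forall es, uniq (verts es) -> monomial es <> 0.

(** The commutator acts through a monomial in distinct letters, which shows in the
    coordinate of yet another letter. *)
Lemma nested_comm_nontrivial k :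
  ~ normal_subgroup_set relator_subgroup [~ (nested_comm (@free_gen nat) 0 (2 ^ k.+1)).1,
      (nested_comm (@free_gen nat) k 0).2]%g.
Proof.
move=> rel; set a := (2 ^ k.+1)%N in rel.
have ker : normal_subgroup_set act_kernel [~ (nested_comm (@free_gen nat) 0 a).1,
      (nested_comm (@free_gen nat) k 0).2]%g.
  apply: rel; split; first exact: act_kernel_normal.
  exact: act_relator.
have := act_nested 0 a; have := act_nested k 0.
have := nested_data_bounds k 0; have := nested_data_uniq k 0.
case: (nested_comm _ k 0) ker => [u y] /= ker.
case: nested_data => [[es1 es2] j] /andP[_ Uy] /andP[_ By] [_ _ yP] [u0 u'P _].
have e : vect_one = scaled_step (monomial ((a, a.+1) :: es2)) j vect_one.
  have -> := monomial_cat [:: (a, a.+1)] es2.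
  by rewrite -(act_commg_shear u0 u'P yP) ?(ker vect_one) //; exact: rowspan0.
have {}e : monomial ((j, a.+2) :: (a, a.+1) :: es2) = 0.
  have := congr1 (fun p => p.2 a.+2) e; rewrite /= add0r mulr1 => ->.
  by rewrite /monomial big_cons mulrC.
case/andP: By; rewrite add0n -/a => ja /allP esa.
case/andP: Uy => jes ues; apply: monomial_neq0 e.
have new i : (a <= i)%N -> i \notin verts es2.
  by move=> ai; apply/negP => /esa; lia.
have n0 := new a (leqnn _); have n1 := new a.+1 (leqnSn _).
have n2 := new a.+2 (leqW (leqnSn _)).
rewrite [verts _]/= -!/(verts _) /= !inE ues (negbTE jes) (negbTE n0) (negbTE n1).
by rewrite (negbTE n2); lia.
Qed.

End Model.

(** * Two-colourings and matchings *)

Section Colourings.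
Implicit Types (chi : nat -> bool) (v : nat) (vs : seq nat).
Implicit Types (e : nat * nat) (u m tau : seq (nat * nat)).

Definition recolour chi v b w := if w == v then b else chi w.

(** The parity of the number of colourings of [vs] that satisfy [f], if [vs] has no
    duplicates; vertices outside [vs] get the colour [false]. *)
Fixpoint colour_sum vs (f : (nat -> bool) -> bool) : bool :=
  if vs is v :: vs' then
    colour_sum vs' (fun chi => f (recolour chi v false) (+) f (recolour chi v true))
  else f xpred0.

Lemma eq_colour_sum vs f g : f =1 g -> colour_sum vs f = colour_sum vs g.
Proof. by elim: vs f g => /= [|v vs IH] f g fg //; apply: IH => chi; rewrite !fg. Qed.

Lemma colour_sumD vs f g :
  colour_sum vs (fun chi => f chi (+) g chi) = colour_sum vs f (+) colour_sum vs g.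
Proof.
elim: vs f g => //= v vs IH f g; rewrite -IH; apply: eq_colour_sum => chi.
by rewrite -!addbA; congr (_ (+) _); rewrite addbCA.
Qed.

Lemma colour_sum0 vs f : f =1 xpred0 -> colour_sum vs f = false.
Proof.
elim: vs f => /= [|v vs IH] f f0; first exact: f0.
by apply: IH => chi; rewrite !f0.
Qed.

(** The pair [(c, s)] stands for [c] plus the sum of the variables in [s], over the
    field with two elements. *)
Definition affine_form : Type := (bool * seq nat)%type.
Implicit Types l : affine_form.

Definition form_value l chi := l.1 (+) odd (count chi l.2).

Definition involves v l := odd (count_mem v l.2).

Definition form_without v l : affine_form := (l.1, [seq w <- l.2 | w != v]).

(** Substitutes in [l'] the value of [v] for which [l] takes the value [1]. *)
Definition form_subst v l l' : affine_form :=
  if involves v l' then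
    (~~ (l.1 (+) l'.1), (form_without v l).2 ++ (form_without v l').2)
  else form_without v l'.

Lemma form_value_recolour v b l chi : form_value l (recolour chi v b) =
  form_value (form_without v l) chi (+) (involves v l && b).
Proof.
rewrite /form_value /form_without /involves /= -addbA; congr (_ (+) _).
elim: l.2 => //= w s IH; rewrite !oddD {}IH /recolour !oddb.
case: eqVneq => [_|_] /=; rewrite ?oddD ?oddb;
  move: (odd (count chi _)) (odd (count _ s)) => X Y.
  by case: b X Y => [] [] [].
by case: b X Y (chi w) => [] [] [] [].
Qed.

Lemma form_value_subst v l l' chi : involves v l ->
  form_value (form_subst v l l') chi =
  form_value l' (recolour chi v (~~ form_value (form_without v l) chi)).
Proof.
move=> vl; rewrite form_value_recolour /form_subst.
case: ifP => _ /=; last by rewrite addbF.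
rewrite /form_value /= count_cat oddD.
by case: l.1; case: l'.1; case: (odd _); case: (odd _).
Qed.

(** A system with fewer affine equations than unknowns has an even number of
    solutions: a variable is either free or eliminated by one of the equations. *)
Lemma colour_sum_affine vs (L : seq affine_form) : size L < size vs ->
  colour_sum vs (fun chi => all (form_value ^~ chi) L) = false.
Proof.
elim: vs L => // v vs IH L /=; rewrite ltnS => sL.
case: (boolP (has (involves v) L)) => [/hasP[l lL vl]|/hasPn noL]; last first.
  have indep chi b : all (form_value ^~ (recolour chi v b)) L =
      all (fun l => form_value (form_without v l) chi) L.
    apply: eq_in_all => l /noL /negbTE vl.
    by rewrite form_value_recolour vl addbF.
  by apply: colour_sum0 => chi; rewrite !indep addbb.
rewrite -[RHS](IH [seq form_subst v l l' | l' <- rem l L]); last first.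
  rewrite size_map size_rem //; case: (L) lL sL => //.
apply: eq_colour_sum => chi; have pL := perm_to_rem lL.
rewrite !(perm_all _ pL) all_map /= !form_value_recolour vl addbF addbT.
rewrite (eq_all (fun l' => form_value_subst l' chi vl)).
by case: (form_value (form_without v l) chi); rewrite /= ?addbF.
Qed.

Definition proper chi u := all (fun e => chi e.1 != chi e.2) u.

Lemma proper_forms chi u :
  proper chi u = all (form_value ^~ chi) [seq (false, [:: e.1; e.2]) | e <- u].
Proof.
rewrite all_map; apply: eq_all => e /=; rewrite /form_value /=.
by case: (chi _); case: (chi _).
Qed.

Lemma proper_count chi u : proper chi u -> count chi (verts u) = size u.
Proof.
elim: u => //= e u IH /andP[ce /IH <-]; rewrite -/(verts u).
by case: (chi _) ce; case: (chi _).
Qed.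

Lemma size_verts u : size (verts u) = (size u).*2.
Proof. by elim: u => //= e u IH; rewrite -/(verts u) IH. Qed.

Definition colour_test vs tau u chi :=
  [&& proper chi u, proper chi tau & ~~ chi (head 0 vs)].

(** Pairs a monomial [u], as a perfect matching on [vs], with a reference
    matching [tau]. *)
Definition pairing vs tau u :=
  [&& uniq vs, perm_eq (verts tau) vs, perm_eq (verts u) vs
    & colour_sum vs (colour_test vs tau u)].

Lemma perm_verts u u' : perm_eq u u' -> perm_eq (verts u) (verts u').
Proof. by move=> p; apply/perm_flatten/perm_map. Qed.

Lemma pairing_perm vs tau u u' : perm_eq u u' -> pairing vs tau u = pairing vs tau u'.
Proof.
move=> p; rewrite /pairing; congr [&& _, _, _ & _].
  by rewrite (permPl (perm_verts p)).
by apply: eq_colour_sum => chi; rewrite /colour_test /proper (perm_all _ p).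
Qed.

Lemma pairing_nonuniq vs tau u : ~~ uniq (verts u) -> pairing vs tau u = false.
Proof.
move=> nu; apply/negP => /and4P[uvs _ p _]; case/negP: nu.
by rewrite (perm_uniq p).
Qed.

(** A colouring that is proper for [tau] and [m] has three points of each colour
    among the other six, and then the sum of the three products is [1].  What
    remains are the equations of [m], [tau] and the head, which are two fewer
    than the vertices. *)
Lemma pairing_cyclic vs tau m (p q r x y z : nat) :
  pairing vs tau ([:: (p, x); (q, y); (r, z)] ++ m) (+)
  pairing vs tau ([:: (p, y); (q, z); (r, x)] ++ m) (+)
  pairing vs tau ([:: (p, z); (q, x); (r, y)] ++ m) = false.
Proof.
set m1 := _ ++ _; set m2 := _ ++ _; set m3 := _ ++ _.
have p2 : perm_eq (verts m2) (verts m1).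
  by apply/permP => P /=; lia.
have p3 : perm_eq (verts m3) (verts m1).
  by apply/permP => P /=; lia.
rewrite /pairing (permPl p2) (permPl p3).
case: (boolP (uniq vs)) => //= uvs; case: (boolP (perm_eq _ vs)) => //= ptau.
case: (boolP (perm_eq _ vs)) => //= pm1; rewrite -!colour_sumD.
pose forms : seq affine_form := (true, [:: head 0 vs]) ::
  [seq (false, [:: e.1; e.2]) | e <- m ++ tau].
rewrite -[RHS](@colour_sum_affine vs forms); last first.
  rewrite -(perm_size ptau) /= size_map size_cat.
  have := perm_size pm1; rewrite -(perm_size ptau) !size_verts /=; lia.
apply: eq_colour_sum => chi; rewrite /colour_test /=.
rewrite -proper_forms {1}/form_value /= /proper all_cat.
case: (boolP (all _ m)) => [cm|]; last by rewrite !andbF.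
case: (boolP (all _ tau)) => [ct|]; last by rewrite !andbF.
have : count chi (verts m1) = (size m).+3.
  have := perm_size pm1; rewrite (permP pm1) -(permP ptau) -(perm_size ptau).
  by rewrite proper_count // !size_verts /=; lia.
rewrite /= -/(verts m) proper_count //.
rewrite -[(size m).+3]/(3 + size m) !addnA => /addIn.
case: (chi (head 0 vs)); rewrite ?andbF //= ?andbT.
by case: (chi p); case: (chi q); case: (chi r); case: (chi x); case: (chi y);
  case: (chi z).
Qed.

(** The identity holds for each colouring, as the condition on an edge is the sum of the
    colours of its ends. *)
Lemma pairing_plucker vs tau m (i j k l : nat) :
  pairing vs tau ([:: (i, j); (k, l)] ++ m) (+)
  pairing vs tau ([:: (i, k); (j, l)] ++ m) (+)
  pairing vs tau ([:: (i, l); (j, k)] ++ m) = false.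
Proof.
set m1 := _ ++ _; set m2 := _ ++ _; set m3 := _ ++ _.
have p2 : perm_eq (verts m2) (verts m1).
  by apply/permP => P /=; lia.
have p3 : perm_eq (verts m3) (verts m1).
  by apply/permP => P /=; lia.
rewrite /pairing (permPl p2) (permPl p3).
case: (boolP (uniq vs)) => //= uvs; case: (boolP (perm_eq _ vs)) => //= ptau.
case: (boolP (perm_eq _ vs)) => //= pm1; rewrite -!colour_sumD.
apply: colour_sum0 => chi; rewrite /colour_test /proper /m1 /m2 /m3 /=.
by case: (all _ m); case: (all _ tau); case: (chi (head 0 vs));
  case: (chi i); case: (chi j); case: (chi k); case: (chi l).
Qed.

(** Joins the edges of a matching into a single cycle from [a] to [a]. *)
Fixpoint closing a b u : seq (nat * nat) :=
  if u is e :: u' then (b, e.1) :: closing a e.2 u' else [:: (b, a)].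

Definition closing_cycle u := if u is e :: u' then closing e.1 e.2 u' else [::].

Lemma perm_closing a b u :
  perm_eq (verts (closing a b u)) (a :: b :: verts u).
Proof.
elim: u b => [|e u IH] b; first by rewrite (perm_catC [:: b] [:: a]).
rewrite -[verts (closing _ _ _)]/([:: b; e.1] ++ verts (closing a e.2 u)).
rewrite (permPl (perm_cat (perm_refl _) (IH e.2))).
by rewrite (perm_catCA [:: b; e.1] [:: a]).
Qed.

Lemma proper_closing chi a b u : ~~ chi a -> chi b ->
  proper chi u && proper chi (closing a b u) =
  all (fun e => ~~ chi e.1 && chi e.2) u.
Proof.
move=> ca; elim: u b => [|e u IH] b cb /=; first by rewrite cb (negbTE ca).
rewrite -/(proper _ _) -/(proper _ _) cb.
case c1: (chi e.1); case c2: (chi e.2) => //=; rewrite ?andbF //.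
by rewrite -(IH _ c2).
Qed.

(** The conditions determine the colour of every vertex. *)
Lemma colour_sum_unique u : uniq (verts u) ->
  colour_sum (verts u) (fun chi => all (fun e => ~~ chi e.1 && chi e.2) u).
Proof.
elim: u => //= -[a b] u IH /=; rewrite -!/(verts u) inE negb_or.
case/and3P=> /andP[ab au] bu uu; have := IH uu; congr is_true.
apply: eq_colour_sum => chi.
have skip (xi : nat -> bool) v c : v \notin verts u ->
    all (fun e => ~~ recolour xi v c e.1 && recolour xi v c e.2) u =
    all (fun e => ~~ xi e.1 && xi e.2) u.
  elim: (u) => //= e w IHw; rewrite -/(verts w) !inE !negb_or.
  by case/and3P=> v1 v2 /IHw ->; rewrite /recolour !(eq_sym _ v) (negbTE v1) (negbTE v2).
by rewrite !skip // /recolour !eqxx eq_sym (negbTE ab) /=; case: (all _ _).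
Qed.

(** Along the cycle the colours alternate, and the head has colour [false]. *)
Lemma pairing_closing u : uniq (verts u) -> u != [::] ->
  pairing (verts u) (closing_cycle u) u.
Proof.
case: u => // e u uu _; apply/and4P; split=> //; first exact: perm_closing.
have := colour_sum_unique uu; congr is_true; apply: eq_colour_sum => chi.
rewrite /colour_test /= -/(proper _ _).
case c1: (chi e.1); rewrite ?andbF //= andbT.
by case c2: (chi e.2) => //=; rewrite -(@proper_closing chi e.1 e.2) ?c1.
Qed.

End Colourings.

(** * The ring of matchings *)

Section MatchingRing.
Local Open Scope quotient_scope.
Implicit Types (u m w tau : seq (nat * nat)) (vs : seq nat).

(** A list of monomials stands for their sum modulo 2. *)
Definition edge_sum : Type := seq (seq (nat * nat)).
HB.instance Definition _ := Choice.on edge_sum.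
Implicit Types x y z : edge_sum.

Definition sum_pairing x m vs tau :=
  \big[addb/false]_(u <- x) pairing vs tau (u ++ m).

(** The argument [m] makes this a congruence for the product. *)
Definition same_pairing x y : bool :=
  `[< forall m vs tau, sum_pairing x m vs tau = sum_pairing y m vs tau >].

Lemma same_pairing_equiv : equiv_class_of same_pairing.
Proof.
split=> [x|x y|y x z]; first by apply/asboolP.
  by apply/asboolP/asboolP => e m vs tau; rewrite e.
by move=> /asboolP e /asboolP e'; apply/asboolP => m vs tau; rewrite e e'.
Qed.

Canonical same_pairing_rel := EquivRelPack same_pairing_equiv.

Definition matching_ring := {eq_quot same_pairing_rel}.
HB.instance Definition _ := Choice.on matching_ring.
HB.instance Definition _ := EqQuotient.on matching_ring.

Definition msum x : matching_ring := \pi_matching_ring x.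

Lemma msum_eq x y :
  msum x = msum y <-> forall m vs tau, sum_pairing x m vs tau = sum_pairing y m vs tau.
Proof.
by split=> [/eqmodP/asboolP //|e]; apply/eqmodP/asboolP.
Qed.

Lemma msum_repr (p : matching_ring) : msum (repr p) = p.
Proof. exact: reprK. Qed.

Lemma sum_pairingD x y m vs tau : sum_pairing (x ++ y) m vs tau =
  sum_pairing x m vs tau (+) sum_pairing y m vs tau.
Proof. exact: big_cat. Qed.

Definition edge_mul x y : edge_sum := [seq u ++ w | u <- x, w <- y].

Lemma sum_pairingM x y m vs tau : sum_pairing (edge_mul x y) m vs tau =
  \big[addb/false]_(w <- y) sum_pairing x (w ++ m) vs tau.
Proof.
rewrite /sum_pairing big_allpairs_dep exchange_big; apply: eq_bigr => w _.
by apply: eq_bigr => u _; rewrite catA.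
Qed.

Lemma sum_pairingMC x y m vs tau :
  sum_pairing (edge_mul x y) m vs tau = sum_pairing (edge_mul y x) m vs tau.
Proof.
rewrite /sum_pairing !big_allpairs_dep exchange_big; apply: eq_bigr => w _.
apply: eq_bigr => u _; apply: pairing_perm.
by rewrite perm_cat2r perm_catC.
Qed.

Definition madd (p q : matching_ring) := msum (repr p ++ repr q).
Definition mmul (p q : matching_ring) := msum (edge_mul (repr p) (repr q)).

Lemma maddE x y : madd (msum x) (msum y) = msum (x ++ y).
Proof.
apply/msum_eq => m vs tau; rewrite !sum_pairingD.
by congr (_ (+) _); move: m vs tau; apply/msum_eq; rewrite msum_repr.
Qed.

Lemma mmulE x y : mmul (msum x) (msum y) = msum (edge_mul x y).
Proof.
have mulr z z' t : msum z = msum z' -> msum (edge_mul z t) = msum (edge_mul z' t).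
  move=> /msum_eq e; apply/msum_eq => m vs tau; rewrite !sum_pairingM.
  by apply: eq_bigr => w _; rewrite e.
have mulC z t : msum (edge_mul z t) = msum (edge_mul t z).
  by apply/msum_eq => m vs tau; rewrite sum_pairingMC.
rewrite /mmul (mulr _ x); last exact: msum_repr.
by rewrite mulC (mulr _ y) 1?mulC //; apply: msum_repr.
Qed.

Fact maddA : associative madd.
Proof.
by move=> p q r; rewrite -(msum_repr p) -(msum_repr q) -(msum_repr r) !maddE catA.
Qed.
Fact maddC : commutative madd.
Proof.
move=> p q; rewrite -(msum_repr p) -(msum_repr q) !maddE.
by apply/msum_eq => m vs tau; rewrite !sum_pairingD addbC.
Qed.
Fact madd0 : left_id (msum [::]) madd.
Proof. by move=> p; rewrite -(msum_repr p) maddE. Qed.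
Fact maddN : left_inverse (msum [::]) id madd.
Proof.
move=> p; rewrite -(msum_repr p) maddE; apply/msum_eq => m vs tau.
by rewrite sum_pairingD addbb /sum_pairing big_nil.
Qed.

HB.instance Definition _ := GRing.isZmodule.Build matching_ring
  maddA maddC madd0 maddN.

Fact mmulA : associative mmul.
Proof.
move=> p q r; rewrite -(msum_repr p) -(msum_repr q) -(msum_repr r) !mmulE.
apply/msum_eq => m vs tau; rewrite /sum_pairing !big_allpairs_dep.
apply: eq_bigr => u _; rewrite !big_allpairs_dep.
by apply: eq_bigr => v _; apply: eq_bigr => w _; rewrite catA.
Qed.
Fact mmulC : commutative mmul.
Proof.
move=> p q; rewrite -(msum_repr p) -(msum_repr q) !mmulE.
by apply/msum_eq => m vs tau; rewrite sum_pairingMC.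
Qed.
Fact mmul1 : left_id (msum [:: [::]]) mmul.
Proof.
move=> p; rewrite -(msum_repr p) mmulE; apply/msum_eq => m vs tau.
by rewrite sum_pairingMC sum_pairingM big_seq1.
Qed.
Fact mmulDl : left_distributive mmul madd.
Proof.
move=> p q r; rewrite -(msum_repr p) -(msum_repr q) -(msum_repr r).
rewrite !(mmulE, maddE); apply/msum_eq => m vs tau.
rewrite sum_pairingD !sum_pairingM -big_split; apply: eq_bigr => w _.
exact: sum_pairingD.
Qed.

HB.instance Definition _ := GRing.Zmodule_isComPzRing.Build matching_ring
  mmulA mmulC mmul1 mmulDl.

Definition edge (i j : nat) : matching_ring := msum [:: [:: (i, j)]].

Local Open Scope ring_scope.

Lemma matching_char2 (p : matching_ring) : p + p = 0.
Proof. exact: maddN. Qed.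

Lemma msumD x y : msum (x ++ y) = msum x + msum y.
Proof. exact: esym (maddE x y). Qed.

Lemma msum_cat u w : msum [:: u ++ w] = msum [:: u] * msum [:: w].
Proof. exact: esym (mmulE [:: u] [:: w]). Qed.

Lemma msum_eq0 x : (forall m vs tau, sum_pairing x m vs tau = false) -> msum x = 0.
Proof. by move=> e; apply/msum_eq => m vs tau; rewrite e /sum_pairing big_nil. Qed.

Lemma msum3 u v w : msum [:: u] + msum [:: v] + msum [:: w] = msum [:: u; v; w].
Proof. by rewrite -(msumD [:: u]) -(msumD [:: u; v]). Qed.

Lemma edge_sym i j : edge i j = edge j i.
Proof.
apply/msum_eq => m vs tau; rewrite /sum_pairing !big_seq1 /pairing.
have -> : perm_eq (verts ([:: (i, j)] ++ m)) vs = perm_eq (verts ([:: (j, i)] ++ m)) vs.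
  exact: (perm_catCA [:: i] [:: j] (verts m) vs).
congr [&& _, _, _ & _]; apply: eq_colour_sum => chi.
by rewrite /colour_test /= eq_sym.
Qed.

Lemma edge_alt i : edge i i = 0.
Proof.
apply: msum_eq0 => m vs tau; rewrite /sum_pairing big_seq1.
by apply: pairing_nonuniq; rewrite /= inE eqxx.
Qed.

Lemma edge_nil i j k : edge i j * edge i k = 0.
Proof.
rewrite /edge -(msum_cat [:: (i, j)]).
apply: msum_eq0 => m vs tau; rewrite /sum_pairing big_seq1.
by apply: pairing_nonuniq; rewrite /= !inE eqxx !orbT.
Qed.

Lemma edge_plucker i j k l :
  edge i j * edge k l + edge i k * edge j l + edge i l * edge j k = 0.
Proof.
rewrite /edge -!msum_cat msum3; apply: msum_eq0 => m vs tau.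
by rewrite /sum_pairing !big_cons big_nil addbF addbA pairing_plucker.
Qed.

Lemma edge_cyclic (p q r x y z : nat) : edge p x * edge q y * edge r z
  + edge p y * edge q z * edge r x + edge p z * edge q x * edge r y = 0.
Proof.
rewrite /edge -!msum_cat msum3; apply: msum_eq0 => m vs tau.
by rewrite /sum_pairing !big_cons big_nil addbF addbA pairing_cyclic.
Qed.

Lemma monomial_edge u : monomial edge u = msum [:: u].
Proof.
rewrite /monomial; elim: u => [|e u IH]; first by rewrite big_nil.
by rewrite big_cons IH -[e :: u]/([:: e] ++ u) msum_cat /edge; case: e.
Qed.

(** A nonempty monomial pairs to [1] with the matching that closes it into a cycle;
    the empty one is tested after multiplication by an edge. *)
Lemma monomial_edge_neq0 u : uniq (verts u) -> monomial edge u <> 0.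
Proof.
rewrite monomial_edge => uu /msum_eq.
suff [m um nm] : exists2 m, uniq (verts (u ++ m)) & u ++ m != [::].
  move/(_ m (verts (u ++ m)) (closing_cycle (u ++ m))).
  by rewrite /sum_pairing big_seq1 big_nil pairing_closing.
case: u uu => [|e u] uu; first by exists [:: (0, 1)]%N.
by exists [::]; rewrite cats0.
Qed.

End MatchingRing.

(** * Non-solvability of the freest group *)

Local Open Scope classical_set_scope.
Local Open Scope group_scope.

Lemma nested_comm_relators k : ~ normal_subgroup_set relator_subgroup
  [~ (nested_comm (@free_gen nat) 0 (2 ^ k.+1)).1, (nested_comm (@free_gen nat) k 0).2].
Proof.
exact: (nested_comm_nontrivial matching_char2 edge_sym edge_alt edge_nil
  edge_plucker edge_cyclic monomial_edge_neq0).
Qed.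

Lemma nested_comm_morphism (G L : groupType) (f : G -> L) (e : nat -> G) k s :
  {morph f : x y / x * y} ->
  f (nested_comm e k s).1 = (nested_comm (f \o e) k s).1 /\
  f (nested_comm e k s).2 = (nested_comm (f \o e) k s).2.
Proof.
move=> fM; elim: k s => [|k IH] s /=; first by rewrite (morphismR fM).
have [] := IH s; have [] := IH (s + 2 ^ k.+1)%N.
case: (nested_comm e k _) => u' y' /= _ ey'.
case: (nested_comm e k _) => u y /= eu ey.
case: (nested_comm _ k _) ey' => v' z' /= ey'.
by case: (nested_comm _ k _) eu ey => v z /= eu ey;
  rewrite !(morphismR fM) eu ey ey'.
Qed.

Lemma eq_nested_comm (G : groupType) (e e' : nat -> G) k s :
  (forall i, s <= i < s + 2 ^ k.+1 -> e i = e' i)%N ->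
  nested_comm e k s = nested_comm e' k s.
Proof.
elim: k s => [|k IH] s ee' /=; first by rewrite !ee' //; lia.
rewrite (IH s) => [|i Hi]; last by apply: ee'; rewrite expnS; lia.
by rewrite (IH (s + _)%N) // => i Hi; apply: ee'; rewrite (expnS _ k.+1); lia.
Qed.

Lemma nested_comm_derived (G : groupType) (e : nat -> G) k s :
  derived G k (nested_comm e k s).1 /\ derived G k (nested_comm e k s).2.
Proof.
elim: k s => [//|k IH] s /=; have [] := IH s; have [] := IH (s + 2 ^ k.+1)%N.
case: (nested_comm e k _) => u' y' /= _ dy'.
case: (nested_comm e k _) => u y /= du dy.
by split=> B [_]; apply; [exists y => //; exists y' | exists u => //; exists y'].
Qed.

Section NestedEngel.
Variables (G : groupType) (e : nat -> G).
Hypothesis e2 : forall i, e i ^+ 2 = 1.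
Hypothesis eE : forall i, left_2Engel (e i).

Lemma nested_comm_closure k s :
  exists i, normal_closure [set e i] (nested_comm e k s).2.
Proof.
elim: k s => [|k IH] s /=; first by exists s => B [_]; apply.
have [i Ni] := IH (s + 2 ^ k.+1)%N; exists i; move: Ni.
case: (nested_comm e k _) => u' y' /= Ny'; case: (nested_comm e k _) => u y /=.
have [gN NJ] := normal_closure_normal [set e i]; rewrite commgEr.
by apply: (is_subgroupM gN) => //; apply: NJ; apply: (is_subgroupV gN).
Qed.

(** As an involution, [y] commutes with all squares, and the commutator of two
    involutions is the square of their product. *)
Lemma right_2Engel_nested_comm k s a : right_2Engel (nested_comm e k s).2 ->
  [~ (nested_comm e 0 a).1, (nested_comm e k s).2] = 1.
Proof.
move=> rP; have eV i : (e i)^-1 = e i.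
  by apply: (mulgI (e i)); rewrite mulgV -(e2 i) expgS expg1.
have r2 : (nested_comm e k s).2 ^+ 2 = 1.
  have [i Ni] := nested_comm_closure k s.
  exact: normal_closure_exponent2 (e2 i) (left_2Engel_closure_abelian (eE i)) _ Ni.
apply/eqP/commgP/commute_sym.
have -> : (nested_comm e 0 a).1 = (e a * e a.+1) ^+ 2.
  by rewrite expgS expg1 /= /commg /conjg !eV !mulgA.
exact: right_2Engel_commute_square.
Qed.

(** If the derived subgroup were trivial, the nested commutator would be right
    2-Engel, and its commutator with [[~ x_a, x_b]] would be trivial in [H]. *)
Lemma derived_mod_R2_neq1 k (f : G -> H) : {morph f : x y / x * y} ->
  (forall i, i < 2 ^ k.+1 + 2 -> f (e i) = gen i)%N ->
  derived (quotient (R2 G)) k <> [set 1].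
Proof.
move=> fM fe dk; apply: (@nested_comm_relators k).
apply/coset_eq1; rewrite (morphismR (@cosetM _ _)).
have cE k' s : (s + 2 ^ k'.+1 <= 2 ^ k.+1 + 2)%N ->
    nested_comm (coset relator_subgroup \o @free_gen nat) k' s =
    nested_comm (f \o e) k' s.
  move=> le; apply: eq_nested_comm => i' Hi' /=; rewrite fe //; lia.
have [-> _] := nested_comm_morphism (@free_gen nat) 0 (2 ^ k.+1) (@cosetM _ relator_subgroup).
have [_ ->] := nested_comm_morphism (@free_gen nat) k 0 (@cosetM _ relator_subgroup).
rewrite !cE //; try lia.
have [<- _] := nested_comm_morphism e 0 (2 ^ k.+1) fM.
have [_ <-] := nested_comm_morphism e k 0 fM.
rewrite -(morphismR fM) right_2Engel_nested_comm ?(morphism1 fM) //.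
suff : coset (R2 G) (nested_comm e k 0).2 = 1 by move/coset_eq1.
have [_ ->] := nested_comm_morphism e k 0 (@cosetM _ (R2 G)).
have [_] := nested_comm_derived (coset (R2 G) \o e) k 0.
by rewrite dk.
Qed.

End NestedEngel.

Section FreestGroup.

Lemma gen_square i : gen i ^+ 2 = 1.
Proof.
rewrite /gen -(morphismX (@cosetM _ _)); apply/coset_eq1 => B [_]; apply.
by left; left; exists i.
Qed.

Lemma gen_left_2Engel i : left_2Engel (gen i).
Proof.
move=> x; have [f <-] := coset_surj x.
have -> : [~ coset relator_subgroup f, gen i, gen i] =
    coset relator_subgroup [~ f, free_gen i, free_gen i].
  by rewrite !(morphismR (@cosetM _ _)).
apply/coset_eq1 => B [_]; apply.
by left; right; exists f => //; exists i.
Qed.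

Lemma H_exponent4 (x : H) : x ^+ 4 = 1.
Proof.
have [f <-] := coset_surj x.
rewrite -(morphismX (@cosetM _ _)); apply/coset_eq1 => B [_]; apply.
by right; exists f.
Qed.

Lemma gen_generated : generated (range gen) = setT.
Proof.
have := generated_morphism (@cosetM _ _) (@coset_surj _ relator_subgroup)
  (free_generated nat).
by rewrite image_comp.
Qed.

Theorem Hbar_not_solvable : ~ solvable_group Hbar.
Proof.
by case=> k; apply: (derived_mod_R2_neq1 gen_square gen_left_2Engel (f := id)).
Qed.

Theorem Hbar_left_2Engel (u : Hbar) : involution u -> left_2Engel u.
Proof.
move: u; apply: (quotient_left_2Engel gen_generated _ _ H_exponent4) => _ [i _ <-];
  [exact: gen_square | exact: gen_left_2Engel].
Qed.

Section Subgroup.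
Variable n : nat.

Definition sub_val (x : Hsub n) : H := val x.

Lemma valM_sub : {morph sub_val : x y / x * y}.
Proof. by []. Qed.

Lemma gen_sub_square (i : 'I_n) : gen_sub i ^+ 2 = 1.
Proof.
apply: val_inj; rewrite -[LHS]/(sub_val _) (morphismX valM_sub).
exact: gen_square.
Qed.

Lemma gen_sub_left_2Engel (i : 'I_n) : left_2Engel (gen_sub i).
Proof.
move=> x; apply: val_inj; rewrite -[LHS]/(sub_val _) !(morphismR valM_sub).
exact: gen_left_2Engel.
Qed.

Lemma Hsub_exponent4 (x : Hsub n) : x ^+ 4 = 1.
Proof.
apply: val_inj; rewrite -[LHS]/(sub_val _) (morphismX valM_sub).
exact: H_exponent4.
Qed.

Lemma gen_sub_generated : generated (range (@gen_sub n)) = setT.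
Proof.
rewrite -subTset => -[x Hx] _; have gS := generated_subgroup (range (@gen_sub n)).
have gx : generated [set gen i | i in `I_n] x by exact: set_mem Hx.
suff: forall y, generated [set gen i | i in `I_n] y ->
    exists2 z : Hsub n, generated (range (@gen_sub n)) z & val z = y.
  by move/(_ x gx) => [z Sz zx]; rewrite (_ : exist _ _ _ = z) //; apply: val_inj.
apply: generated_left_ind => [|_ y [i /= ni <-] [z Sz <-]].
  by exists 1; [exact: gS.1 |].
have Sg : generated (range (@gen_sub n)) (gen_sub (Ordinal ni)).
  by move=> B [_]; apply; exists (Ordinal ni).
split; [exists (gen_sub (Ordinal ni) * z) | exists ((gen_sub (Ordinal ni))^-1 * z)] => //.
  exact: (is_subgroupM gS).
by apply: (is_subgroupM gS) => //; apply: (is_subgroupV gS).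
Qed.

Lemma Hbarn_left_2Engel (u : Hbarn n) : involution u -> left_2Engel u.
Proof.
move: u.
apply: (quotient_left_2Engel gen_sub_generated _ _ Hsub_exponent4) => _ [i _ <-];
  [exact: gen_sub_square | exact: gen_sub_left_2Engel].
Qed.

Lemma Hbarn_derived_neq1 k : (2 ^ k.+1 + 2 <= n)%N -> derived (Hbarn n) k <> [set 1].
Proof.
move=> kn; pose e i : Hsub n := oapp (@gen_sub n) 1 (insub i).
have e2 i : e i ^+ 2 = 1.
  by rewrite /e; case: insub => [j|] /=; rewrite ?expg1n //; apply: gen_sub_square.
have eE i : left_2Engel (e i).
  rewrite /e; case: insub => [j|] /=; first exact: gen_sub_left_2Engel.
  by move=> x; rewrite commg1.
apply: (derived_mod_R2_neq1 e2 eE valM_sub) => i ik.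
by rewrite /e insubT //=; lia.
Qed.

End Subgroup.
End FreestGroup.

(** * Finiteness *)

Lemma derived1 (G : groupType) k : derived G k 1.
Proof.
case: k => [//|k].
by have [] := generated_subgroup
  [set [~ x, y] | x in derived G k & y in derived G k].
Qed.

Lemma derived_eq1 (G : groupType) k : derived G k `<=` [set 1] -> derived G k = [set 1].
Proof. by move=> le; rewrite eqEsubset; split=> // _ ->; apply: derived1. Qed.

Lemma derived_stable (G : groupType) k l : derived G k = [set 1] -> (k <= l)%N ->
  derived G l = [set 1].
Proof.
move=> dk /subnK <-; elim: (l - k)%N => // j IH; rewrite addSn; apply: derived_eq1.
apply: smallest_sub => [|_ [x xj [y yj <-]]].
  by split=> // x y -> ->; rewrite /= mulgV.
have := xj : derived G (j + k)%N x; have := yj : derived G (j + k)%N y.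
by rewrite IH => -> ->; rewrite /= commg1.
Qed.

Lemma derived_morphism (G L : groupType) (f : G -> L) k x :
  {morph f : x y / x * y} -> derived G k x -> derived L k (f x).
Proof.
move=> fM; elim: k x => [//|k IH] x /=.
set D := generated [set [~ x, y] | x in derived L k & y in derived L k].
have [g1 gF] : is_subgroup D by exact: generated_subgroup.
suff sub : generated [set [~ x, y] | x in derived G k & y in derived G k]
    `<=` [set x | D (f x)] by apply: sub.
apply: smallest_sub => [|_ [a da [b db <-]]].
  split=> [|a b /= fa fb]; first by rewrite /= (morphism1 fM).
  by rewrite fM (morphismV fM); apply: gF.
apply: generated_sub; rewrite (morphismR fM).
by exists (f a); [exact: IH | exists (f b); first exact: IH].
Qed.

(** An involution that commutes with a subgroup and lies outside it doubles the
    number of elements. *)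
Lemma enum_commuting_involutions (G : groupType) (L : seq G) :
  {in L, forall x, x ^+ 2 = 1} -> {in L &, forall x y, commute x y} ->
  exists s j, [/\ uniq s, forall x, generated [set` L] x <-> x \in s
    & size s = (2 ^ j)%N].
Proof.
elim: L => [|a L IH] L2 LC.
  exists [:: 1], 0%N; split=> // x; rewrite inE; split=> [|/eqP ->].
    move=> Lx; apply/eqP; apply: (Lx [set 1]); split=> //.
    by split=> // y z -> ->; rewrite /= mulgV.
  exact: (generated_subgroup _).1.
have [||s [j [us sP ss]]] := IH.
- by move=> x xL; apply: L2; rewrite inE xL orbT.
- by move=> x y xL yL; apply: LC; rewrite inE ?xL ?yL orbT.
pose P := generated [set` L]; pose P' := generated [set` a :: L].
have gP : is_subgroup P := generated_subgroup _.
have gP' : is_subgroup P' := generated_subgroup _.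
have aV : a^-1 = a.
  have a2 : a ^+ 2 = 1 by apply: L2; rewrite mem_head.
  by apply: (mulgI a); rewrite mulgV -a2 expgS expg1.
have aC y : P y -> commute a y.
  have : P `<=` [set y | commute a y]; last exact.
  apply: smallest_sub => [|x xL] /=; last first.
    by apply: LC; rewrite inE ?xL ?orbT ?eqxx.
  by split=> [|x z ax az]; [exact: commute1 | apply: commuteM => //; exact: commuteV].
have PP' : P `<=` P'.
  by apply: smallest_sub => // x xL; apply: generated_sub; rewrite /= inE xL orbT.
have P'a : P' a by apply: generated_sub; rewrite /= mem_head.
have P'E x : P' x <-> P x \/ exists2 z, P z & x = a * z.
  split=> [|[/PP' //|[z /PP' Pz ->]]]; last exact: (is_subgroupM gP').
  have : P' `<=` [set x | P x \/ exists2 z, P z & x = a * z]; last exact.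
  apply: smallest_sub => [|y /=]; last first.
    rewrite inE => /orP[/eqP ->|yL]; last by left; apply: generated_sub.
    by right; exists 1; [exact: gP.1 | rewrite mulg1].
  have PV z : P z -> P z^-1 by exact: (is_subgroupV gP).
  have PM y z : P y -> P z -> P (y * z) by exact: (is_subgroupM gP).
  split; first by left; apply: gP.1.
  move=> y z /= [Py|[y' Py ->]] [Pz|[z' Pz ->]].
  - by left; apply: gP.2.
  - right; exists (y * z'^-1); first exact: gP.2.
    by rewrite invgM aV mulgA -(aC (y * z'^-1)) //; apply: gP.2.
  - by right; exists (y' * z^-1); [exact: gP.2 | rewrite mulgA].
  - left; have Pyz : P (y' * z'^-1) by exact: gP.2.
    by rewrite invgM mulgA -(mulgA a) (aC _ Pyz) -mulgA mulgV mulg1.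
case: (EM (P a)) => [Pa|Pa].
  exists s, j; split=> // x; rewrite -sP -/P' P'E; split=> [[//|[z Pz ->]]|]; last by left.
  exact: (is_subgroupM gP).
exists (s ++ [seq a * x | x <- s]), j.+1; split.
- rewrite cat_uniq us (map_inj_uniq (@mulgI _ a)) us andbT /=.
  apply/hasPn => _ /mapP[x /sP Px ->]; apply/negP => /sP Pax; apply: Pa.
  by rewrite -[a](mulgK x); apply: gP.2.
- move=> x; rewrite mem_cat -/P' P'E; split=> [[/sP -> //|[z /sP zs ->]]|/orP[/sP|]].
  + by apply/orP; right; apply: map_f.
  + by left.
  + by case/mapP=> z /sP Pz ->; right; exists z.
- by rewrite size_cat size_map ss addnn -mul2n expnS.
Qed.

Lemma generated_normal (G : groupType) (S : set G) :
  (forall x g, S x -> S (x ^ g)) -> is_normal_subgroup (generated S).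
Proof.
move=> SJ; have gS := generated_subgroup S; split=> // x g Sx; move: x Sx.
have : generated S `<=` [set x | generated S (x ^ g)]; last exact.
apply: smallest_sub => [|x Sx]; last by apply: generated_sub; apply: SJ.
split=> [|x y /= Sx Sy]; first by rewrite /= conj1g; apply: gS.1.
by rewrite conjMg conjVg; apply: gS.2.
Qed.

Section InvolutionExtension.
Variables (G : groupType) (a : G).
Hypothesis a2 : a ^+ 2 = 1.
Hypothesis aE : left_2Engel a.

Let A := NormalSubgroup (normal_closure_normal [set a]).
Let Q : groupType := quotient A.

(** As its normal closure is abelian, [a] has at most one conjugate for each coset
    of the closure. *)
Lemma closure_enum (sQ : seq Q) : (forall q, q \in sQ) ->
  exists s j, [/\ uniq s, forall x, normal_closure [set a] x <-> x \in s
    & size s = (2 ^ j)%N].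
Proof.
move=> sQP; have abA := left_2Engel_closure_abelian aE.
have [gA AJ] := normal_closure_normal [set a].
have Aa : normal_closure [set a] a by move=> B [_]; apply.
pose L := [seq a ^ repr q | q <- sQ].
have LA x : x \in L -> normal_closure [set a] x.
  by case/mapP=> q _ ->; apply: AJ.
have La g : a ^ g \in L.
  have -> : a ^ g = a ^ repr (coset A g).
    have /coset_eqP : coset A (repr (coset A g)) = coset A g by rewrite coset_repr.
    set r := repr _ => Arg; rewrite -[g](mulVKg r) conjgM.
    by apply/conjg_fixP/commgP/abA => //; apply: AJ.
  exact: map_f.
have [||s [j [us sP ss]]] := @enum_commuting_involutions G L.
- by move=> x /LA; apply: normal_closure_exponent2.
- by move=> x y /LA Ax /LA Ay; apply: abA.
exists s, j; split=> // x; rewrite -sP; split; move: x.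
  have : normal_closure [set a] `<=` generated [set` L]; last exact.
  apply: smallest_sub => [|_ ->].
    by apply: generated_normal => x g /mapP[q _ ->]; rewrite -conjgM; apply: La.
  by apply: generated_sub; rewrite /= -[X in X \in _]conjg1; apply: La.
have : generated [set` L] `<=` normal_closure [set a]; last exact.
by apply: smallest_sub => // x /LA.
Qed.

Lemma extension_enum (sQ : seq Q) k : uniq sQ -> (forall q, q \in sQ) ->
  size sQ = (2 ^ k)%N ->
  exists s j, [/\ uniq s, forall x : G, x \in s & size s = (2 ^ j)%N].
Proof.
move=> uQ sQP sQk; have [s [j [us sP ss]]] := closure_enum sQP.
exists [seq repr q * x | q <- sQ, x <- s], (k + j)%N; split.
- apply: allpairs_uniq => // -[q x] [q' x'] /allpairsP[[p y] [/= _ ys [-> ->]]].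
  case/allpairsP=> -[p' y'] [/= _ ys' [-> ->]] e.
  have cA z : z \in s -> coset A z = 1 by move=> /sP Az; apply/coset_eq1.
  have pp : p = p'.
    have := congr1 (coset A) e; rewrite /= !cosetM !coset_repr.
    by rewrite (cA _ ys) (cA _ ys') !mulg1.
  by move: e; rewrite /= pp => /mulgI ->.
- move=> x; apply/allpairsP; exists (coset A x, (repr (coset A x))^-1 * x).
  split=> //=; last by rewrite mulVKg.
  apply/sP; have /coset_eqP : coset A (repr (coset A x)) = coset A x.
    by rewrite coset_repr.
  by [].
- by rewrite size_allpairs sQk ss expnD.
Qed.

End InvolutionExtension.

(** Induction through the quotient by the normal closure of the last generator,
    which is a finite elementary abelian 2-group. *)
Lemma involutions_finite_solvable n (G : groupType) (g : nat -> G) :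
  generated [set g i | i in `I_n] = setT ->
  (forall i, g i ^+ 2 = 1) -> (forall i, left_2Engel (g i)) ->
  derived G n = [set 1] /\
  exists s j, [/\ uniq s, forall x : G, x \in s & size s = (2 ^ j)%N].
Proof.
elim: n G g => [|n IH] G g gG g2 gE.
  have triv (x : G) : x = 1.
    have sub : generated [set g i | i in `I_0] `<=` [set 1].
      apply: smallest_sub; last by move=> y [i]; rewrite /= ltn0.
      by split=> // y z -> ->; rewrite /= mulgV.
    by apply: sub; rewrite gG.
  split; first by apply: derived_eq1 => x _; apply: triv.
  by exists [:: 1], 0%N; split=> // x; rewrite inE (triv x).
pose A := NormalSubgroup (normal_closure_normal [set g n]).
have [] := IH (quotient A) (coset A \o g).
- have := generated_morphism (@cosetM _ A) (@coset_surj _ A) gG.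
  rewrite -!subTset => le q /le; move: q.
  have [g1 gF] := generated_subgroup [set (coset A \o g) i | i in `I_n].
  set B := generated _ in g1 gF *.
  have : generated (coset A @` [set g i | i in `I_n.+1]) `<=` B; last exact.
  apply: smallest_sub => // _ [_ [i /= ni <-] <-].
  have [lt|ge] := ltnP i n; first by apply: generated_sub; exists i.
  have -> : i = n by apply/eqP; rewrite eqn_leq ge -ltnS ni.
  suff -> : coset A (g n) = 1 by [].
  by apply/coset_eq1 => C [_]; apply.
- by move=> i; rewrite /= -(morphismX (@cosetM _ _)) g2.
- move=> i q; have [x <-] := coset_surj q.
  by have := congr1 (coset A) (gE i x); rewrite !(morphismR (@cosetM _ A)).
move=> dQ [sQ [k [uQ sQP sQk]]]; split; last first.
  exact: (extension_enum (g2 n) (gE n) uQ sQP sQk).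
apply: derived_eq1; apply: smallest_sub => [|_ [x dx [y dy <-]]].
  by split=> // y z -> ->; rewrite /= mulgV.
have dA z : derived G n z -> normal_closure [set g n] z.
  move=> /(derived_morphism (@cosetM _ A)); rewrite dQ => /= e.
  exact: (coset_eq1 A z).1 e.
apply/eqP/commgP/(left_2Engel_closure_abelian (gE n)); exact: dA.
Qed.

Lemma enum_finite_pgroup (G : groupType) (s : seq G) p j : uniq s ->
  (forall x, x \in s) -> size s = (p ^ j)%N -> finite_pgroup G p.
Proof.
move=> us sP sj; exists j; apply/card_set_bijP.
exists (index ^~ s); split=> [x _|x y _ _ e|i /= ij].
- by rewrite /= -sj index_mem.
- by rewrite -(nth_index 1 (sP x)) e nth_index.
- by exists (nth 1 s i); rewrite ?index_uniq ?sj.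
Qed.

(** * The finite quotients *)

Section FiniteQuotients.
Variable n : nat.
Let cM := @cosetM _ (R2 (Hsub n)).

Lemma gen_bar_square (i : 'I_n) : gen_bar i ^+ 2 = 1.
Proof. by rewrite /gen_bar -(morphismX cM) gen_sub_square. Qed.

Lemma gen_bar_left_2Engel (i : 'I_n) : left_2Engel (gen_bar i).
Proof.
move=> q; have [x <-] := coset_surj q.
by have := congr1 (coset (R2 (Hsub n))) (gen_sub_left_2Engel i x);
  rewrite !(morphismR cM).
Qed.

Lemma Hbarn_exponent4 (q : Hbarn n) : q ^+ 4 = 1.
Proof.
by have [x <-] := coset_surj q; rewrite -(morphismX cM) Hsub_exponent4.
Qed.

Lemma gen_bar_generated : generated (range (@gen_bar n)) = setT.
Proof.
have := generated_morphism cM (@coset_surj _ (R2 (Hsub n))) (@gen_sub_generated n).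
by rewrite image_comp.
Qed.

Lemma Hbarn_finite_solvable : derived (Hbarn n) n = [set 1] /\ finite_pgroup (Hbarn n) 2.
Proof.
pose g i : Hbarn n := oapp (@gen_bar n) 1 (insub i).
have [|i|i|dn [s [j [us sP sj]]]] := @involutions_finite_solvable n _ g.
- rewrite -gen_bar_generated; congr generated; rewrite eqEsubset; split.
    by move=> _ [i /= ni <-]; exists (Ordinal ni); rewrite ?/g ?insubT.
  by move=> _ [i _ <-]; exists i => //=; rewrite /g valK.
- rewrite /g; case: insub => [k|] /=; [exact: gen_bar_square | by rewrite expg1n].
- rewrite /g; case: insub => [k|] /=; first exact: gen_bar_left_2Engel.
  by move=> x; rewrite commg1.
- by split=> //; apply: enum_finite_pgroup sj.
Qed.

End FiniteQuotients.

Lemma has_derived_length_exists (G : groupType) k : derived G k = [set 1] ->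
  exists l, has_derived_length G l.
Proof.
move=> dk; have ex : exists k, `[< derived G k = [set 1] >].
  by exists k; apply/asboolP.
exists (ex_minn ex); case: ex_minnP => l /asboolP dl lmin.
by split=> // m dm; apply: lmin; apply/asboolP.
Qed.

Theorem theorem1p2 :
  [/\ forall u : Hbar, involution u -> left_2Engel u,
      ~ solvable_group Hbar,
      forall n : nat, (0 < n)%N ->
        [/\ finite_pgroup (Hbarn n) 2,
            generated (range (@gen_bar n)) = setT,
            forall i : 'I_n, gen_bar i ^+ 2 = 1 /\
              abelian_set (normal_closure [set gen_bar i]),
            forall h : Hbarn n, h ^+ 4 = 1
          & forall u : Hbarn n, involution u -> left_2Engel u]
    & forall B : nat, exists n l : nat,
        [/\ (0 < n)%N, has_derived_length (Hbarn n) l & (B < l)%N]].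
Proof.
split; [exact: Hbar_left_2Engel | exact: Hbar_not_solvable | move=> n _ | move=> B].
  split; [exact: (Hbarn_finite_solvable n).2 | exact: gen_bar_generated | | |].
  - move=> i; split; first exact: gen_bar_square.
    by apply/left_2Engel_closure_abelian/gen_bar_left_2Engel.
  - exact: Hbarn_exponent4.
  - exact: Hbarn_left_2Engel.
pose n := (2 ^ B.+1 + 2)%N.
have [l lP] := has_derived_length_exists (Hbarn_finite_solvable n).1.
exists n, l; split=> //; first by rewrite /n addn2.
rewrite ltnNge; apply/negP => lB.
exact: (@Hbarn_derived_neq1 n B (leqnn _) (derived_stable lP.1 lB)).
Qed.
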